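(* Suppose $(X_t)_{t>0}$ is a quadratic harness with parameters $q,\eta,\theta,\sigma,\tau$ such that $0\le\sigma\tau<1$ and $-1<q\le1-2\sqrt{\sigma\tau}$. Moreover, assume that for each $t>0$ the random variable $X_t$ has moments of all orders and infinite support. Then $(X_t)$ has orthogonal martingale polynomials, which are given by the recurrence $$x\,p_n(x;t)=a_n(t)p_{n+1}(x;t)+b_n(t)p_n(x;t)+c_n(t)p_{n-1}(x;t),\quad n\ge1,$$ with $p_0(x;t)=1$, $p_1(x;t)=x$, where $$a_n(t)=\sigma\alpha_{n+1}t+\beta_{n+1},\quad b_n(t)=\gamma_nt+\delta_n,\quad c_n(t)=(\beta_nt+\tau\alpha_n)\omega_n,$$ and the sequences are determined as follows. (1) $\alpha_1=0$, $\beta_1=1$, $\gamma_0=\delta_0=0$, $\omega_1=1$. (2) For $n\ge1$: $\alpha_{n+1}=q\alpha_n+\beta_n$ and $\beta_{n+1}=-\sigma\tau\alpha_n+\beta_n$. Moreover, with $\lambda_{n,k}=\beta_n\beta_{n+k}-\sigma\tau\alpha_n\alpha_{n+k}$ we have $\lambda_{n,k}>0$ for all $n\ge1$, $k\ge0$. (3) Setting $\lambda_{0,2}=\alpha_0=\beta_0=0$, for $n\ge0$: $$\gamma_{n+1}=\tfrac{q+\sigma\tau}{\lambda_{n+2,0}}\big(\lambda_{n,2}\gamma_n+(\alpha_{n+2}\beta_n-\beta_{n+2}\alpha_n)\sigma\delta_n\big)+\tfrac{\sigma\alpha_{n+2}}{\lambda_{n+2,0}}(\eta\tau\alpha_{n+1}+\theta\beta_{n+1})+\tfrac{\beta_{n+2}}{\lambda_{n+2,0}}(\theta\sigma\alpha_{n+1}+\eta\beta_{n+1}),$$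 $$\delta_{n+1}=\tfrac{q+\sigma\tau}{\lambda_{n+2,0}}\big(\lambda_{n,2}\delta_n+(\alpha_{n+2}\beta_n-\beta_{n+2}\alpha_n)\tau\gamma_n\big)+\tfrac{\beta_{n+2}}{\lambda_{n+2,0}}(\eta\tau\alpha_{n+1}+\theta\beta_{n+1})+\tfrac{\tau\alpha_{n+2}}{\lambda_{n+2,0}}(\theta\sigma\alpha_{n+1}+\eta\beta_{n+1}).$$ (4) For $n\ge2$: $$\omega_{n+1}=\frac{(q+\sigma\tau)\lambda_{n-1,1}}{\lambda_{n+1,1}}\omega_n+\frac{1+\gamma_n(\tau\gamma_n-\delta_n+\theta)+\delta_n(q\gamma_n+\sigma\delta_n+\eta)}{\lambda_{n+1,1}},$$ with $$\omega_2=(1+q)\frac{(1-\sigma\tau)^2+(\eta+\theta\sigma)(\theta+\eta\tau)}{(1-\sigma\tau)^2(1-\sigma\tau(2+q))}.$$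
   Context: Equalities between conditional expectations hold almost surely. $(X_t)_{t>0}$ is a separable square-integrable real process; $\mathcal F_{s,u}=\sigma\{X_t:t\in(0,s]\cup[u,\infty)\}$, $\mathcal F_{\le s}=\sigma\{X_t:0<t\le s\}$; $\mathrm{Var}[X\mid\mathcal F]=\mathbb{E}[X^2\mid\mathcal F]-(\mathbb{E}[X\mid\mathcal F])^2$; $\Delta_{s,u}=\frac{X_u-X_s}{u-s}$, $\widetilde\Delta_{s,u}=\frac{uX_s-sX_u}{u-s}$. For real $q,\eta,\theta$ and $\sigma,\tau\ge0$, $(X_t)$ is a quadratic harness with parameters $q,\eta,\theta,\sigma,\tau$ if $\mathbb{E}(X_t)=0$, $\mathbb{E}(X_sX_t)=\min\{s,t\}$ for all $s,t>0$, and for all $0<s<t<u$ $$\mathbb{E}[X_t\mid\mathcal F_{s,u}]=\tfrac{u-t}{u-s}X_s+\tfrac{t-s}{u-s}X_u,$$ $$\mathrm{Var}[X_t\mid\mathcal F_{s,u}]=\tfrac{(u-t)(t-s)}{u(1+\sigma s)+\tau-qs}\Big(1+\eta\widetilde\Delta_{s,u}+\theta\Delta_{s,u}+\sigma\widetilde\Delta_{s,u}^2+\tau\Delta_{s,u}^2-(1-q)\Delta_{s,u}\widetilde\Delta_{s,u}\Big).$$ Orthogonal martingale polynomials for $(X_t)$: polynomials $p_n(x;t)$ in $x$ of degree $n$ with $\mathbb{E}[p_n(X_t;t)\mid\mathcal F_{\le s}]=p_n(X_s;s)$ for all $0<s<t$, $n\ge0$, and $\mathbb{E}(p_n(X_t;t)p_m(X_t;t))=0$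 for all $t>0$, $n\ne m$. ''$X_t$ has infinite support'' means the support of the law of $X_t$ is an infinite set. *)

(* Defs.v *)
From HB Require Import structures.
From mathcomp Require Import all_boot all_order all_algebra.
From mathcomp Require Import all_classical all_reals all_analysis.

Set Implicit Arguments.
Unset Strict Implicit.
Unset Printing Implicit Defensive.

Import Order.TTheory GRing.Theory Num.Theory.
Import numFieldNormedType.Exports.

Local Open Scope classical_set_scope.
Local Open Scope ring_scope.

Section ConditionalExpectation.
Context (d : measure_display) (T : measurableType d) (R : realType).
Context (P : probability T R).

(* [F] is meant to be a sub-sigma-algebra of [T]; versions are measurable with
   respect to [F] itself, which need not contain the [P]-negligible sets. *)
Definition cond_exp_version (F : set_system T) (X Y : T -> R) : Prop :=
  [/\ X \in Lfun P 1%E, Y \in Lfun P 1%E,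
      preimage_set_system setT Y measurable `<=` F &
      forall A : set T, F A ->
        (\int[P]_(w in A) (Y w)%:E = \int[P]_(w in A) (X w)%:E)%E].

(* E[X | F] = Y almost surely. *)
Definition is_cond_exp (F : set_system T) (X Y : T -> R) : Prop :=
  exists2 E1 : T -> R, cond_exp_version F X E1 &
    {ae P, forall w, E1 w = Y w}.

(* Var[X | F] = V almost surely. *)
Definition is_cond_var (F : set_system T) (X V : T -> R) : Prop :=
  exists E1 E2 : T -> R,
    [/\ cond_exp_version F X E1,
        cond_exp_version F (fun w => X w ^+ 2) E2 &
        {ae P, forall w, E2 w - E1 w ^+ 2 = V w}].

End ConditionalExpectation.

(* Processes are indexed by all of [R], but only the variables [X t] with
   [0 < t] are ever used. *)
Section Process.
Context (d : measure_display) (T : measurableType d) (R : realType).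
Context (P : probability T R) (X : R -> {RV P >-> R}).

Definition sigma_gen (I : set R) : set_system T :=
  <<s \bigcup_(t in I) preimage_set_system setT (X t) measurable >>.

Definition past_future (s u : R) : set_system T :=
  sigma_gen [set t | 0 < t <= s \/ u <= t].

Definition past (s : R) : set_system T := sigma_gen [set t | 0 < t <= s].

(* Separability in the sense of Doob, relative to the closed sets. Taking
   [K = set0] shows that a separating set is dense in the half-line. *)
Definition separable_process : Prop :=
  exists D : set R, exists N : set T,
    [/\ countable D, D `<=` [set t | 0 < t], P.-negligible N &
        forall (a b : R) (K : set R), 0 <= a -> a < b -> closed K ->
          [set w | forall t, a < t < b -> D t -> K (X t w)] `\`
          [set w | forall t, a < t < b -> K (X t w)] `<=` N].

Definition square_integrable : Prop :=
  forall t : R, 0 < t -> (X t : T -> R) \in Lfun P 2%:E.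

Definition Delta (s u : R) (w : T) : R := (X u w - X s w) / (u - s).

Definition tDelta (s u : R) (w : T) : R :=
  (u * X s w - s * X u w) / (u - s).

Record quadratic_harness (q eta theta sigma tau : R) : Prop := {
  qh_sigma : 0 <= sigma ;
  qh_tau : 0 <= tau ;
  qh_mean : forall t : R, 0 < t -> 'E_P[X t]%E = 0%E ;
  qh_cov : forall s t : R, 0 < s -> 0 < t ->
    'E_P[(fun w => X s w * X t w)%R]%E = (Num.min s t)%:E ;
  qh_cond_exp : forall s t u : R, 0 < s -> s < t -> t < u ->
    is_cond_exp P (past_future s u) (X t)
      (fun w => (u - t) / (u - s) * X s w + (t - s) / (u - s) * X u w) ;
  qh_cond_var : forall s t u : R, 0 < s -> s < t -> t < u ->
    is_cond_var P (past_future s u) (X t)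
      (fun w => (u - t) * (t - s) / (u * (1 + sigma * s) + tau - q * s) *
        (1 + eta * tDelta s u w + theta * Delta s u w +
         sigma * tDelta s u w ^+ 2 + tau * Delta s u w ^+ 2 -
         (1 - q) * Delta s u w * tDelta s u w)) }.

Definition all_moments : Prop := forall (t : R) (n : nat), 0 < t ->
  (fun w => X t w ^+ n) \in Lfun P 1%E.

(* [p n t] is the polynomial x |-> p_n(x;t). *)
Record orthogonal_martingale_polys (p : nat -> R -> {poly R}) : Prop := {
  omp_degree : forall (n : nat) (t : R), 0 < t -> size (p n t) = n.+1 ;
  omp_martingale : forall (n : nat) (s t : R), 0 < s -> s < t ->
    is_cond_exp P (past s) (fun w => (p n t).[X t w])
      (fun w => (p n s).[X s w]) ;
  omp_orthogonal : forall (n m : nat) (t : R), 0 < t -> n != m ->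
    'E_P[(fun w => (p n t).[X t w] * (p m t).[X t w])%R]%E = 0%E }.

End Process.

Definition msupport (R : realType) (mu : set R -> \bar R) : set R :=
  [set x | forall U : set R, open U -> U x -> (0 < mu U)%E].

Definition infinite_support (d : measure_display) (T : measurableType d)
    (R : realType) (P : probability T R) (X : {RV P >-> R}) : Prop :=
  infinite_set (msupport (distribution P X)).

Section Coefficients.
Context (R : realType) (q eta theta sigma tau : R).
Context (alpha beta gamma delta omega : nat -> R).

Definition lam (n k : nat) : R :=
  beta n * beta (n + k)%N - sigma * tau * alpha n * alpha (n + k)%N.

Definition coef_a (n : nat) (t : R) : R :=
  sigma * alpha n.+1 * t + beta n.+1.

Definition coef_b (n : nat) (t : R) : R := gamma n * t + delta n.

Definition coef_c (n : nat) (t : R) : R :=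
  (beta n * t + tau * alpha n) * omega n.

(* [alpha 0 = beta 0 = 0] also gives the convention [lam 0 2 = 0]; the value
   [omega 0] plays no role. *)
Record qh_coefficients : Prop := {
  qc_alpha0 : alpha 0%N = 0 ;
  qc_beta0 : beta 0%N = 0 ;
  qc_alpha1 : alpha 1%N = 0 ;
  qc_beta1 : beta 1%N = 1 ;
  qc_gamma0 : gamma 0%N = 0 ;
  qc_delta0 : delta 0%N = 0 ;
  qc_omega1 : omega 1%N = 1 ;
  qc_alphaS : forall n, (1 <= n)%N -> alpha n.+1 = q * alpha n + beta n ;
  qc_betaS : forall n, (1 <= n)%N ->
    beta n.+1 = - (sigma * tau) * alpha n + beta n ;
  qc_gammaS : forall n, gamma n.+1 =
    (q + sigma * tau) / lam n.+2 0 *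
      (lam n 2 * gamma n +
       (alpha n.+2 * beta n - beta n.+2 * alpha n) * sigma * delta n) +
    sigma * alpha n.+2 / lam n.+2 0 *
      (eta * tau * alpha n.+1 + theta * beta n.+1) +
    beta n.+2 / lam n.+2 0 *
      (theta * sigma * alpha n.+1 + eta * beta n.+1) ;
  qc_deltaS : forall n, delta n.+1 =
    (q + sigma * tau) / lam n.+2 0 *
      (lam n 2 * delta n +
       (alpha n.+2 * beta n - beta n.+2 * alpha n) * tau * gamma n) +
    beta n.+2 / lam n.+2 0 *
      (eta * tau * alpha n.+1 + theta * beta n.+1) +
    tau * alpha n.+2 / lam n.+2 0 *
      (theta * sigma * alpha n.+1 + eta * beta n.+1) ;
  qc_omega2 : omega 2%N =
    (1 + q) * (((1 - sigma * tau) ^+ 2 +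
                (eta + theta * sigma) * (theta + eta * tau)) /
               ((1 - sigma * tau) ^+ 2 * (1 - sigma * tau * (2 + q)))) ;
  qc_omegaS : forall n, (2 <= n)%N -> omega n.+1 =
    (q + sigma * tau) * lam n.-1 1 / lam n.+1 1 * omega n +
    (1 + gamma n * (tau * gamma n - delta n + theta) +
     delta n * (q * gamma n + sigma * delta n + eta)) / lam n.+1 1 }.

Definition three_term_recurrence (p : nat -> R -> {poly R}) : Prop :=
  forall t : R, 0 < t ->
    [/\ p 0%N t = 1, p 1%N t = 'X &
        forall n, (1 <= n)%N ->
          'X * p n t = coef_a n t *: p n.+1 t + coef_b n t *: p n t +
                       coef_c n t *: p n.-1 t].

End Coefficients.

(* Main.v *)
Require Import Defs.
From HB Require Import structures.
From mathcomp Require Import all_boot all_order all_algebra.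
From mathcomp Require Import all_classical all_reals all_analysis.
From mathcomp Require Import finmap measurable_realfun.
From mathcomp Require Import zify ring lra.

Set Implicit Arguments.
Unset Strict Implicit.
Unset Printing Implicit Defensive.

Import Order.TTheory GRing.Theory Num.Theory.
Import numFieldNormedType.Exports.

Local Open Scope classical_set_scope.
Local Open Scope ring_scope.

(* Let p_n be defined by the three-term recurrence and write it in terms of the
   Jacobi matrices x and y, multiplication by X_t acting on (p_n) as t x + y.
   The recursions (1)-(4) for the coefficients say exactly that
     x y - q y x = 1 + eta y + theta x + sigma y^2 + tau x^2,
   which is the quadratic harness condition tested on p_n(X_u; u).

   Martingale property, by induction on n: if p_0, ..., p_n are martingales then
   computing E[X_t p_n(X_u) | F_s] and E[X_t^2 p_{n-1}(X_u) | F_s] in two ways,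
   by conditioning on F_t and by the harness condition, gives two homogeneous
   linear equations for the defects E[p_{n+1}(X_r) | F_s] - p_{n+1}(X_s) at
   r = t and r = u, whose determinant is a positive multiple of a_n(s).

   Orthogonality: E p_n(X_t) does not depend on t, and
   a_n(s) E p_{n+1} = E[X_s p_n(X_1)] tends to 0 with s, while a_n(s) stays
   above beta_{n+1} > 0. So E p_n = 0 for n >= 1, and by the recurrence
   X_t^m p_n(X_t) has mean 0 for m < n. *)

(** * The coefficients *)

Section Coefficients.
Context (R : realType) (q eta theta sigma tau : R).
Hypotheses (sigma_ge0 : 0 <= sigma) (tau_ge0 : 0 <= tau).
Hypotheses (st_lt1 : sigma * tau < 1) (q_gtN1 : -1 < q).
Hypothesis q_le : q <= 1 - 2 * Num.sqrt (sigma * tau).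

Lemma qh_alpha_beta_exist : exists alpha beta : nat -> R,
  [/\ alpha 0%N = 0 /\ beta 0%N = 0, alpha 1%N = 0 /\ beta 1%N = 1,
      forall n, (1 <= n)%N -> alpha n.+1 = q * alpha n + beta n &
      forall n, (1 <= n)%N ->
        beta n.+1 = - (sigma * tau) * alpha n + beta n].
Proof.
pose step (ab : R * R) :=
  (q * ab.1 + ab.2, - (sigma * tau) * ab.1 + ab.2).
(* The iteration starts at index 1 from (0, 1). Index 0 is set apart because [step] fixes (0, 0) and
   would never reach (0, 1). *)
pose ab n := if n is m.+1 then iter m step (0, 1) else (0, 0).
by exists (fun n => (ab n).1), (fun n => (ab n).2); split=> // -[|n].
Qed.

Lemma qh_coefficients_exist : exists alpha beta gamma delta omega : nat -> R,
  qh_coefficients q eta theta sigma tau alpha beta gamma delta omega.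
Proof.
have [al [be [[al0 be0] [al1 be1] alS beS]]] := qh_alpha_beta_exist.
pose L := lam sigma tau al be.
(* [gamma] and [delta] are coupled, so they are built as pairs. Division is total, so the recursions
   define sequences before the denominators are known to be positive. *)
pose gd := fix gd n := if n is n.+1 then
  let g := (gd n).1 in let e := (gd n).2 in
  ((q + sigma * tau) / L n.+2 0 *
      (L n 2 * g + (al n.+2 * be n - be n.+2 * al n) * sigma * e) +
    sigma * al n.+2 / L n.+2 0 * (eta * tau * al n.+1 + theta * be n.+1) +
    be n.+2 / L n.+2 0 * (theta * sigma * al n.+1 + eta * be n.+1),
   (q + sigma * tau) / L n.+2 0 *
      (L n 2 * e + (al n.+2 * be n - be n.+2 * al n) * tau * g) +
    be n.+2 / L n.+2 0 * (eta * tau * al n.+1 + theta * be n.+1) +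
    tau * al n.+2 / L n.+2 0 * (theta * sigma * al n.+1 + eta * be n.+1))
  else (0 : R, 0 : R).
pose om := fix om n : R := match n with
  | 0 | 1 => 1
  | 2 => (1 + q) * (((1 - sigma * tau) ^+ 2 +
                (eta + theta * sigma) * (theta + eta * tau)) /
               ((1 - sigma * tau) ^+ 2 * (1 - sigma * tau * (2 + q))))
  | n.+1 => let g := (gd n).1 in let e := (gd n).2 in
     (q + sigma * tau) * L n.-1 1 / L n.+1 1 * om n +
     (1 + g * (tau * g - e + theta) + e * (q * g + sigma * e + eta))
       / L n.+1 1
  end.
exists al, be, (fun n => (gd n).1), (fun n => (gd n).2), om.
by split=> // -[|[|n]].
Qed.

Context (alpha beta gamma delta omega : nat -> R).
Hypothesis qc :
  qh_coefficients q eta theta sigma tau alpha beta gamma delta omega.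
Local Notation r := (Num.sqrt (sigma * tau)).
Local Notation L := (lam sigma tau alpha beta).

Lemma sqr_sqrt_st : r ^+ 2 = sigma * tau.
Proof. by rewrite sqr_sqrtr ?mulr_ge0. Qed.

Lemma sqrt_st_ge0 : 0 <= r. Proof. exact: sqrtr_ge0. Qed.

Lemma sqrt_st_lt1 : r < 1.
Proof.
by rewrite -(ltr_pXn2r (ltn0Sn 1)) ?nnegrE ?sqrt_st_ge0 // sqr_sqrt_st expr1n.
Qed.

Lemma alphaSS n : alpha n.+2 = q * alpha n.+1 + beta n.+1.
Proof. exact: qc_alphaS qc _ _. Qed.

Lemma betaSS n : beta n.+2 = - (sigma * tau) * alpha n.+1 + beta n.+1.
Proof. exact: qc_betaS qc _ _. Qed.

(* The slack beta_n - sqrt(sigma tau) alpha_n shrinks at most by the factor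
   1 - sqrt(sigma tau); positivity of alpha_n is carried along, by its
   second-order recurrence when q + sigma tau <= 0. *)
Lemma alpha_beta_gt n :
  [/\ 0 <= alpha n.+1, 0 < alpha n.+2 & r * alpha n.+1 < beta n.+1].
Proof.
have := q_le; have := sqr_sqrt_st; have := sqrt_st_lt1; have := sqrt_st_ge0.
move: r => s r0 r1 r2 qs.
elim: n => [|n [a0 a1 b]].
  by rewrite alphaSS (qc_alpha1 qc) (qc_beta1 qc) !mulr0; split; lra.
have b' : s * alpha n.+2 < beta n.+2.
  rewrite -subr_gt0 (_ : _ - _ = (1 - s) * (beta n.+1 - s * alpha n.+1) +
    s * (1 - 2 * s - q) * alpha n.+1); last first.
    by rewrite alphaSS betaSS -r2; ring.
  apply: ltr_wpDr; first by rewrite !mulr_ge0 // subr_ge0; lra.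
  by rewrite mulr_gt0 ?subr_gt0.
split; [exact: ltW| |by []].
have [qr|qr] := lerP (q + s ^+ 2) 0.
  rewrite (_ : alpha n.+3 = (1 + q) * alpha n.+2 +
    - (q + s ^+ 2) * alpha n.+1); last
      by rewrite (alphaSS n.+1) betaSS (alphaSS n) r2; ring.
  apply: ltr_wpDr; first by rewrite mulr_ge0 // oppr_ge0.
  by rewrite mulr_gt0 // -ltrBlDl sub0r.
have {}qr : 0 <= q + s by rewrite (le_trans (ltW qr)) // lerD2l expr2 ler_piMl
  // ltW.
rewrite (_ : alpha n.+3 = (q + s) * alpha n.+2 + (beta n.+2 - s * alpha n.+2)).
  by apply: ltr_wpDl; [rewrite mulr_ge0 // ltW | rewrite subr_gt0].
by rewrite alphaSS; ring.
Qed.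

Lemma alpha_ge0 n : 0 <= alpha n.+1.
Proof. by have [] := alpha_beta_gt n. Qed.

Lemma beta_gt0 n : 0 < beta n.+1.
Proof.
by have [a0 _ b] := alpha_beta_gt n;
  rewrite (le_lt_trans _ b) ?mulr_ge0 ?sqrtr_ge0.
Qed.

(** This is the product of the inequalities sqrt(sigma tau) alpha < beta at the indices n and n + k,
    whose left sides are nonnegative. *)
Lemma lam_gt0 n k : (1 <= n)%N -> 0 < L n k.
Proof.
case: n => // n _; have [a0 _ b] := alpha_beta_gt n.
have [a0' _ b'] := alpha_beta_gt (n + k).
rewrite /lam addSn -sqr_sqrt_st subr_gt0.
rewrite (_ : _ * _ = (r * alpha n.+1) * (r * alpha (n + k).+1)); last by ring.
by rewrite ltr_pM ?mulr_ge0 ?sqrtr_ge0.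
Qed.

Lemma coef_a_gt0 n t : 0 <= t -> 0 < coef_a sigma alpha beta n t.
Proof.
by move=> t0; rewrite /coef_a ltr_wpDl ?beta_gt0 // !mulr_ge0 ?alpha_ge0.
Qed.

(** For n >= 1 the two brackets are beta_(n+1) and alpha_(n+1), and at n = 0 both sides vanish. This
    gives the entries of the commutation relation two places below the diagonal. *)
Lemma alpha_beta_cross n :
  alpha n.+1 * (beta n - sigma * tau * alpha n) =
  beta n.+1 * (q * alpha n + beta n).
Proof.
case: n => [|n]; first by rewrite (qc_alpha0 qc) (qc_beta0 qc); ring.
by rewrite alphaSS betaSS; ring.
Qed.

Lemma lamE n k : L n k = beta n * beta (n + k)%N - sigma * tau * alpha n *
  alpha (n + k)%N.
Proof. by []. Qed.

(** Inverts the step from (alpha_n, beta_n) to (alpha_(n+1), beta_(n+1)), a matrix of determinant q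
    + sigma tau. The step fails from index 0 to 1, and the factors gamma_n, delta_n, zero at n = 0,
    keep the identities true there. *)
Lemma gamma_delta_prev n :
  [/\ (q + sigma * tau) * beta n * gamma n =
        (q * beta n.+1 + sigma * tau * alpha n.+1) * gamma n,
      (q + sigma * tau) * beta n * delta n =
        (q * beta n.+1 + sigma * tau * alpha n.+1) * delta n,
      (q + sigma * tau) * alpha n * gamma n =
        (alpha n.+1 - beta n.+1) * gamma n &
      (q + sigma * tau) * alpha n * delta n =
        (alpha n.+1 - beta n.+1) * delta n].
Proof.
case: n => [|n]; last by rewrite alphaSS betaSS; split; ring.
by rewrite (qc_gamma0 qc) (qc_delta0 qc) !mulr0.
Qed.

(** The entries of the commutation relation next to the diagonal, the lower one divided by
    omega_(n+1). They form a 2 by 2 linear system for gamma_(n+1) and delta_(n+1), and the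
    recursions (3) are its solution by Cramer's rule. *)
Lemma gamma_delta_commutation n :
  beta n.+1 * gamma n.+1 + delta n * (sigma * alpha n.+1) -
    q * (sigma * alpha n.+1 * delta n.+1 + gamma n * beta n.+1) =
  eta * beta n.+1 + theta * (sigma * alpha n.+1) +
    sigma * (beta n.+1 * (delta n.+1 + delta n)) +
    tau * (sigma * alpha n.+1 * (gamma n.+1 + gamma n)) /\
  delta n.+1 * beta n.+1 + tau * alpha n.+1 * gamma n -
    q * (gamma n.+1 * (tau * alpha n.+1) + beta n.+1 * delta n) =
  eta * (tau * alpha n.+1) + theta * beta n.+1 +
    sigma * (tau * alpha n.+1 * (delta n.+1 + delta n)) +
    tau * (beta n.+1 * (gamma n.+1 + gamma n)).
Proof.
have D0 : L n.+2 0 != 0 by rewrite gt_eqF ?lam_gt0.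
have [Gb Eb Ga Ea] := gamma_delta_prev n.
pose A2 := alpha n.+2; pose B2 := beta n.+2.
pose R2 := eta * beta n.+1 + theta * sigma * alpha n.+1 +
  sigma * delta n * (beta n.+1 - alpha n.+1) +
  gamma n * (q * beta n.+1 + sigma * tau * alpha n.+1).
pose R3 := eta * tau * alpha n.+1 + theta * beta n.+1 +
  tau * gamma n * (beta n.+1 - alpha n.+1) +
  delta n * (q * beta n.+1 + sigma * tau * alpha n.+1).
have Eg : L n.+2 0 * gamma n.+1 = B2 * R2 + sigma * A2 * R3.
  transitivity (B2 * (eta * beta n.+1 + theta * sigma * alpha n.+1
     - sigma * ((q + sigma * tau) * alpha n * delta n)
     + (q + sigma * tau) * beta n * gamma n) +
     sigma * A2 * (eta * tau * alpha n.+1 + theta * beta n.+1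
     - tau * ((q + sigma * tau) * alpha n * gamma n)
     + (q + sigma * tau) * beta n * delta n)).
    rewrite (qc_gammaS qc) [L n 2]lamE addn2 /A2 /B2; field.
    by [].
  by rewrite Gb Eb Ga Ea /R2 /R3; ring.
have Ed : L n.+2 0 * delta n.+1 = B2 * R3 + tau * A2 * R2.
  transitivity (tau * A2 * (eta * beta n.+1 + theta * sigma * alpha n.+1
     - sigma * ((q + sigma * tau) * alpha n * delta n)
     + (q + sigma * tau) * beta n * gamma n) +
     B2 * (eta * tau * alpha n.+1 + theta * beta n.+1
     - tau * ((q + sigma * tau) * alpha n * gamma n)
     + (q + sigma * tau) * beta n * delta n)).
    rewrite (qc_deltaS qc) [L n 2]lamE addn2 /A2 /B2; field.
    by [].
  by rewrite Gb Eb Ga Ea /R2 /R3; ring.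
(* [L n.+2 0] is the determinant of the system formed by [H2] and [H3]. *)
have lamD : L n.+2 0 = B2 ^+ 2 - sigma * tau * A2 ^+ 2.
  by rewrite lamE addn0 /A2 /B2; ring.
have H2 : B2 * gamma n.+1 - sigma * A2 * delta n.+1 = R2.
  apply: (mulfI D0); rewrite mulrBr !(mulrCA (L _ _)) Eg Ed lamD; ring.
have H3 : B2 * delta n.+1 - tau * A2 * gamma n.+1 = R3.
  apply: (mulfI D0); rewrite mulrBr !(mulrCA (L _ _)) Eg Ed lamD; ring.
move: H2 H3; rewrite /B2 /A2 /R2 /R3 alphaSS betaSS => H2 H3.
split; apply/eqP; rewrite -subr_eq0; apply/eqP.
  by move/eqP: H2; rewrite -subr_eq0 => /eqP <-; ring.
by move/eqP: H3; rewrite -subr_eq0 => /eqP <-; ring.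
Qed.

(** The diagonal entries of the commutation relation. For n >= 2 the coefficient of omega_n is (q +
    sigma tau) lambda_(n-1,1) written in alpha_n and beta_n. At n = 1 it equals q while lambda_(0,1)
    = 0, which is why omega_2 is prescribed separately. *)
Lemma omega_commutation n :
  omega n.+1 * L n.+1 1 =
  (q * beta n ^+ 2 + 2 * (sigma * tau) * alpha n * beta n -
   sigma * tau * alpha n ^+ 2) * omega n +
  (1 + eta * delta n + theta * gamma n + sigma * delta n ^+ 2 +
   tau * gamma n ^+ 2 - (1 - q) * gamma n * delta n).
Proof.
case: n => [|[|n]].
- rewrite lamE addn1 alphaSS betaSS (qc_alpha1 qc) (qc_beta1 qc).
  rewrite (qc_alpha0 qc) (qc_beta0 qc) (qc_omega1 qc) (qc_gamma0 qc).
  by rewrite (qc_delta0 qc); ring.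
- have L21 : L 2 1 = 1 - sigma * tau * (2 + q).
    by rewrite lamE addn1 !betaSS !alphaSS !betaSS (qc_alpha1 qc) (qc_beta1 qc);
      ring.
  have L20 : L 2 0 = 1 - sigma * tau.
    by rewrite lamE addn0 alphaSS betaSS (qc_alpha1 qc) (qc_beta1 qc); ring.
  have D20 : 1 - sigma * tau != 0 by rewrite -L20 gt_eqF ?lam_gt0.
  have D21 : 1 - sigma * tau * (2 + q) != 0 by rewrite -L21 gt_eqF ?lam_gt0.
  have Eg : gamma 1%N = (eta + theta * sigma) / (1 - sigma * tau).
    rewrite (qc_gammaS qc) L20 alphaSS betaSS (qc_alpha1 qc) (qc_beta1 qc).
    by rewrite (qc_gamma0 qc) (qc_delta0 qc); field.
  have Ed : delta 1%N = (theta + eta * tau) / (1 - sigma * tau).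
    rewrite (qc_deltaS qc) L20 alphaSS betaSS (qc_alpha1 qc) (qc_beta1 qc).
    by rewrite (qc_gamma0 qc) (qc_delta0 qc); field.
  rewrite (qc_omega2 qc) L21 (qc_alpha1 qc) (qc_beta1 qc) (qc_omega1 qc) Eg Ed.
  by field; rewrite D20 D21.
- have D := lam_gt0 1 (ltn0Sn n.+2).
  rewrite (qc_omegaS qc) // mulrDl mulrAC !divfK ?gt_eqF //.
  by rewrite [L n.+2.-1 1]lamE addn1 alphaSS betaSS; ring.
Qed.

(* The transposes of the Jacobi matrices x and y for which t x + y has the
   entries coef_a, coef_b, coef_c. *)
Definition jacobi_x (l : nat -> R) (n : nat) : R :=
  sigma * alpha n.+1 * l n.+1 + gamma n * l n + beta n * omega n * l n.-1.

Definition jacobi_y (l : nat -> R) (n : nat) : R :=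
  beta n.+1 * l n.+1 + delta n * l n + tau * alpha n * omega n * l n.-1.

Lemma coef_jacobi (l : nat -> R) n t :
  coef_a sigma alpha beta n t * l n.+1 + coef_b gamma delta n t * l n +
    coef_c tau alpha beta omega n t * l n.-1 =
  t * jacobi_x l n + jacobi_y l n.
Proof. by rewrite /coef_a /coef_b /coef_c /jacobi_x /jacobi_y; ring. Qed.

(** Uses a known equation a = b with multiplier c, when u - v = c (a - b), and leaves an identity
    for [ring]. *)
Lemma eq_lin_comb (c a b u v : R) : a = b -> u + c * b = v + c * a -> u = v.
Proof. by move=> ->; apply: addIr. Qed.

(** Compares the coefficients of each entry of [l] in row n. The entry two above the diagonal agrees
    by the recursions for alpha and beta alone; the other four come from the preceding lemmas, each
    used with its entry of [l] as multiplier. *)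
Lemma q_commutation (l : nat -> R) n :
  jacobi_y (jacobi_x l) n - q * jacobi_x (jacobi_y l) n =
  l n + eta * jacobi_y l n + theta * jacobi_x l n +
  sigma * jacobi_y (jacobi_y l) n + tau * jacobi_x (jacobi_x l) n.
Proof.
have Ea := alphaSS n; have Eb := betaSS n.
have [Egd _] := gamma_delta_commutation n.
have Eo := omega_commutation n.
rewrite lamE addn1 Ea Eb in Eo.
case: n => [|n] in Ea Eb Egd Eo *; rewrite /jacobi_y /jacobi_x /= Ea Eb.
  apply: (eq_lin_comb (c := l 1%N) Egd); apply: (eq_lin_comb (c := l 0%N) Eo).
  by rewrite (qc_alpha0 qc) (qc_beta0 qc); ring.
have [_ Egd'] := gamma_delta_commutation n.
have Ex := alpha_beta_cross n.
apply: (eq_lin_comb (c := l n.+2) Egd); apply: (eq_lin_comb (c := l n.+1) Eo).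
apply: (eq_lin_comb (c := omega n.+1 * l n) Egd').
apply: (eq_lin_comb (c := tau * omega n.+1 * omega n * l n.-1) Ex).
by ring.
Qed.

End Coefficients.

(** * The polynomials *)

Section Polynomials.
Context (R : realType) (sigma tau : R).
Context (alpha beta gamma delta omega : nat -> R).
Hypotheses (al0 : alpha 0%N = 0) (be0 : beta 0%N = 0).
Hypotheses (al1 : alpha 1%N = 0) (be1 : beta 1%N = 1).
Hypotheses (ga0 : gamma 0%N = 0) (de0 : delta 0%N = 0).
Local Notation a := (coef_a sigma alpha beta).
Local Notation b := (coef_b gamma delta).
Local Notation c := (coef_c tau alpha beta omega).
Hypothesis a_gt0 : forall n t, 0 <= t -> 0 < a n t.

Lemma three_term_recurrence_exist : exists p,
  three_term_recurrence sigma tau alpha beta gamma delta omega p.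
Proof.
(* [pp n t] carries the pair of p_n and p_(n+1), as the recurrence has order two. *)
pose pp := fix pp n t : {poly R} * {poly R} :=
  if n is n.+1 then
    let uv := pp n t in (uv.2, (a n.+1 t)^-1 *:
      ('X * uv.2 - b n.+1 t *: uv.2 - c n.+1 t *: uv.1))
  else (1, 'X).
exists (fun n t => (pp n t).1) => t t0; split=> // -[//|n] _ /=.
rewrite scalerA divff ?gt_eqF ?a_gt0 ?ltW // scale1r.
by rewrite addrAC !subrK.
Qed.

Context (p : nat -> R -> {poly R}).
Hypothesis p_rec :
  three_term_recurrence sigma tau alpha beta gamma delta omega p.

(* At n = 0 the truncated index n.-1 is harmless since c_0 = 0. *)
Lemma three_termE n t : 0 < t ->
  'X * p n t = a n t *: p n.+1 t + b n t *: p n t + c n t *: p n.-1 t.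
Proof.
move=> t0; have [p0 p1 pS] := p_rec t0.
case: n => [|n]; last exact: pS.
rewrite /coef_a /coef_b /coef_c /= al1 be1 al0 be0 ga0 de0 p0 p1.
by rewrite mulr1 !(mulr0, mul0r, add0r, addr0, scale0r, scale1r).
Qed.

Lemma three_term_horner n t (x : R) : 0 < t ->
  x * (p n t).[x] =
  a n t * (p n.+1 t).[x] + b n t * (p n t).[x] + c n t * (p n.-1 t).[x].
Proof.
move=> t0; have /(congr1 (fun r => r.[x])) := three_termE n t0.
by rewrite !hornerE.
Qed.

Lemma size_three_term n t : 0 < t -> size (p n t) = n.+1.
Proof.
move=> t0; have [p0 p1 _] := p_rec t0.
suff [] : size (p n t) = n.+1 /\ size (p n.+1 t) = n.+2 by [].
elim: n => [|n [IH IH']]; first by rewrite p0 p1 size_poly1 size_polyX.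
split=> //; have a0 : a n.+1 t != 0 by rewrite gt_eqF ?a_gt0 ?ltW.
rewrite -(size_scale _ a0).
have -> : a n.+1 t *: p n.+2 t =
    'X * p n.+1 t + - (b n.+1 t *: p n.+1 t + c n.+1 t *: p n t).
  by rewrite three_termE // -(addrA (_ *: _)) addrK.
have p_neq0 : p n.+1 t != 0 by rewrite -size_poly_eq0 IH'.
rewrite size_polyDl mulrC size_mulX // IH' // ltnS size_polyN.
rewrite (leq_trans (size_polyD _ _)) // geq_max.
by rewrite !(leq_trans (size_scale_leq _ _)) ?IH ?IH'.
Qed.

End Polynomials.

(** * Conditional expectations *)

Section PullOut.
Import HBSimple HBNNSimple.
Context (d : measure_display) (T : measurableType d) (R : realType).
Context (P : probability T R) (G : set_system T).
Hypothesis G_measurable : <<s G>> `<=` measurable.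
Local Notation T' := (g_sigma_algebraType G).

Lemma measurable_fun_sub (W : T -> R) :
  measurable_fun (setT : set T') W -> measurable_fun setT W.
Proof. by move=> mW _ Y mY; apply: G_measurable; exact: mW. Qed.

Section NonNegative.
Context (D W : T -> R).
Hypothesis D_integrable : P.-integrable setT (EFin \o D).
Hypothesis W_measurable : measurable_fun (setT : set T') W.
Hypothesis WD_integrable : P.-integrable setT (fun w => (W w * D w)%:E).
Hypothesis D_null : forall A, <<s G>> A -> (\int[P]_(w in A) (D w)%:E = 0)%E.

(** W is the increasing limit of simple functions measurable for the generated sigma-algebra. For a
    simple function the integral is a combination of integrals of D over level sets, which vanish;
    dominated convergence with bound |W D| passes to the limit. *)
Lemma integral_pull_out_ge0 : (forall w, 0 <= W w) ->
  (\int[P]_w (W w * D w)%:E = 0)%E.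
Proof.
move=> W0.
have mW : measurable_fun (setT : set T') (EFin \o W).
  exact/measurable_EFinP.
pose g n := nnsfun_approx (measurableT : measurable (setT : set T')) mW n.
have cg w : EFin \o g^~ w @ \oo --> (W w)%:E.
  by apply: cvg_nnsfun_approx => // x _; rewrite lee_fin.
have gW n w : 0 <= g n w <= W w.
  apply/andP; split; first exact: fun_ge0.
  by rewrite -lee_fin /g nnsfun_approxE; apply: le_approx => // x _;
    rewrite lee_fin.
have mg n : measurable_fun setT (g n : T -> R).
  by apply: measurable_fun_sub; exact: measurable_funPT.
have mD : measurable_fun setT D.
  by apply/measurable_EFinP; exact: measurable_int D_integrable.
have E n : (\int[P]_w (g n w * D w)%:E = 0)%E.
  pose A y := g n @^-1` [set y].
  have mA y : <<s G>> (A y).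
    have := measurable_funPT (g n) measurableT _ (measurable_set1 y).
    by rewrite setTI.
  transitivity (\int[P]_w (\sum_(y <- fset_set (range (g n)))
      y%:E * ((EFin \o D) \_ (A y)) w))%E.
    apply: eq_integral => w _.
    rewrite fimfunE fsbig_finite //= mulr_suml -sumEFin.
    apply: eq_bigr => y _ /=; rewrite patchE indicE.
    by case: (w \in A y); rewrite ?(mulr1, mulr0, mul0r, mule0) // EFinM.
  have iA y : P.-integrable setT ((EFin \o D) \_ (A y)).
    rewrite -integrable_mkcond; last exact: G_measurable.
    by apply: integrableS D_integrable => //; exact: G_measurable.
  rewrite integral_sum //; last by move=> y; exact: integrableZl.
  rewrite big1 // => y _; rewrite integralZl //.
  by rewrite -integral_mkcond D_null ?mule0.
have := @dominated_cvg _ _ _ P setT measurableT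
  (fun n w => (g n w * D w)%:E) (fun w => (W w * D w)%:E)
  (fun w => `|W w * D w|%:E).
have -> : (fun n => \int[P]_w (g n w * D w)%:E)%E = cst 0%E.
  by apply/funext => n; exact: E.
move=> H; suff /(cvg_lim (@ereal_hausdorff R)) <- :
    cst 0%E @ \oo --> (\int[P]_w (W w * D w)%:E)%E.
  by rewrite lim_cst.
apply: H => //.
- by move=> n; apply/measurable_EFinP; exact: measurable_funM.
- move=> w _; have /fine_cvgP[_ cw] := cg w.
  by apply: cvg_EFin; [exact: nearW | exact: cvgMl].
- exact: integrable_norm.
- move=> n w _; rewrite lee_fin !normrM ler_wpM2r //.
  by have /andP[g0 gw] := gW n w; rewrite !ger0_norm ?W0.
Qed.
End NonNegative.

Lemma integral_pull_out (D W : T -> R) : P.-integrable setT (EFin \o D) ->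
  measurable_fun (setT : set T') W ->
  P.-integrable setT (fun w => (W w * D w)%:E) ->
  (forall A, <<s G>> A -> (\int[P]_(w in A) (D w)%:E = 0)%E) ->
  (\int[P]_w (W w * D w)%:E = 0)%E.
Proof.
move=> iD mW iWD D0.
have mWT := measurable_fun_sub mW.
have mD : measurable_fun setT D.
  by apply/measurable_EFinP; exact: measurable_int iD.
pose Wp w := Num.max (W w) 0; pose Wn w := Num.max (- W w) 0.
have WE w : W w = Wp w - Wn w.
  by rewrite /Wp /Wn !maxElt; case: ltP => ?; case: ltP => ?; lra.
have mWp : measurable_fun (setT : set T') Wp by exact: measurable_maxr.
have mWn : measurable_fun (setT : set T') Wn.
  by apply: measurable_maxr => //; exact: measurableT_comp.
have Wp_le w : `|Wp w| <= `|W w|.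
  by rewrite ger0_norm ?le_max ?lexx ?orbT // ge_max ler_norm normr_ge0.
have Wn_le w : `|Wn w| <= `|W w|.
  by rewrite ger0_norm ?le_max ?lexx ?orbT // ge_max normr_ge0 -normrN ler_norm.
have le_int (V : T -> R) : measurable_fun (setT : set T') V ->
    (forall w, `|V w| <= `|W w|) -> P.-integrable setT (fun w => (V w * D
      w)%:E).
  move=> mV VW; apply: le_integrable iWD => //.
    by apply/measurable_EFinP; apply: measurable_funM => //;
      exact: measurable_fun_sub.
  by move=> w _; rewrite lee_fin !normrM ler_wpM2r.
have iWp := le_int _ mWp Wp_le; have iWn := le_int _ mWn Wn_le.
transitivity (\int[P]_w ((Wp w * D w)%:E - (Wn w * D w)%:E))%E.
  by apply: eq_integral => w _; rewrite -EFinB -mulrBl -WE.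
rewrite integralB //; rewrite !integral_pull_out_ge0 ?sube0 //.
- by move=> w; rewrite le_max lexx orbT.
- by move=> w; rewrite le_max lexx orbT.
Qed.

(** The difference D of two versions is tested against its own sign, which is measurable for the
    same sigma-algebra. This gives E|D| = 0. *)
Lemma cond_exp_version_unique (X E1 E2 : T -> R) :
  cond_exp_version P <<s G>> X E1 -> cond_exp_version P <<s G>> X E2 ->
  {ae P, forall w, E1 w = E2 w}.
Proof.
move=> [_ /Lfun1_integrable i1 m1 e1] [_ /Lfun1_integrable i2 m2 e2].
have G_meas (f : T -> R) : preimage_set_system setT f measurable `<=` <<s G>> ->
    measurable_fun (setT : set T') f.
  by move=> mf _ Y mY; apply: mf; exists Y.
pose D w := E1 w - E2 w; pose W w : R := if 0 <= D w then 1 else -1.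
have mD : measurable_fun (setT : set T') D.
  by apply: measurable_funB; exact: G_meas.
have iD : P.-integrable setT (EFin \o D)
  by exact: (integrableB measurableT i1 i2).
have WD w : W w * D w = `|D w| 
  by rewrite /W; case: ger0P; rewrite ?mul1r ?mulN1r.
have mW : measurable_fun (setT : set T') W.
  apply: measurable_fun_ifT => //; exact: measurable_fun_ler.
have D0 : (\int[P]_w (W w * D w)%:E = 0)%E.
  apply: integral_pull_out => //.
    by under eq_fun do rewrite WD; exact: integrable_norm.
  move=> A GA; have mA := G_measurable GA.
  rewrite /D; under eq_integral do rewrite EFinB.
  have iS f : P.-integrable setT (EFin \o f) -> P.-integrable A (EFin \o f).
    exact: integrableS.
  rewrite integralB ?iS // e1 // -e2 // subee //.
  exact: integrable_fin_num (iS _ i2).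
have : ae_eq P setT (EFin \o D) (cst 0%E).
  apply/ae_eq_integral_abs => //.
    by apply/measurable_EFinP; exact: measurable_fun_sub.
  by rewrite -[RHS]D0; apply: eq_integral => w _; rewrite WD.
apply: filterS => w /(_ I)[] /eqP; rewrite subr_eq0; exact: eqP.
Qed.
End PullOut.

(** * The algebra of random variables with finite moments of all orders *)

Section FiniteMoments.
Context (d : measure_display) (T : measurableType d) (R : realType).
Context (P : probability T R).
Implicit Types f g : T -> R.

(** This class is closed under sums and products, unlike the integrable functions, so integrability
    of every polynomial expression follows by closure. *)
Definition finite_moments f : Prop := measurable_fun setT f /\
  forall n, P.-integrable setT (fun w => (`|f w| ^+ n)%:E).

Lemma finite_moments_integrable f : finite_moments f ->
  P.-integrable setT (EFin \o f).
Proof.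
move=> [mf /(_ 1%N) i1]; apply: le_integrable i1 => //;
  first exact/measurable_EFinP.
by move=> w _ /=; rewrite expr1 lee_fin normr_id.
Qed.

Lemma finite_moments_cst (c : R) : finite_moments (fun=> c).
Proof. by split=> // n; exact: finite_measure_integrable_cst. Qed.

Lemma finite_momentsD f g : finite_moments f -> finite_moments g ->
  finite_moments (fun w => f w + g w).
Proof.
move=> [mf If] [mg Ig]; split=> [|n]; first exact: measurable_funD.
(* The bound is |f + g|^n <= 2^n (|f|^n + |g|^n), since |f + g| is at most twice the larger of |f|
   and |g|. *)
apply: le_integrable (integrableZl measurableT (2 ^+ n)
  (integrableD measurableT (If n) (Ig n))) => //.
  apply/measurable_EFinP; apply: measurable_funX; apply: measurableT_comp => //.
  exact: measurable_funD.
move=> w _ /=; rewrite lee_fin normrX normr_id.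
rewrite [leRHS]ger0_norm ?mulr_ge0 ?addr_ge0 ?exprn_ge0 //.
have [fg|/ltW fg] := lerP `|f w| `|g w|.
  apply: (@le_trans _ _ ((2 * `|g w|) ^+ n)).
    by apply: lerXn2r; rewrite ?nnegrE ?mulr_ge0 // mulr_natl mulr2n
      (le_trans (ler_normD _ _)) // lerD2r.
  by rewrite exprMn ler_wpM2l ?exprn_ge0 // lerDr exprn_ge0.
apply: (@le_trans _ _ ((2 * `|f w|) ^+ n)).
  by apply: lerXn2r; rewrite ?nnegrE ?mulr_ge0 // mulr_natl mulr2n
    (le_trans (ler_normD _ _)) // lerD2l.
by rewrite exprMn ler_wpM2l ?exprn_ge0 // lerDl exprn_ge0.
Qed.

Lemma finite_momentsM f g : finite_moments f -> finite_moments g ->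
  finite_moments (fun w => f w * g w).
Proof.
move=> [mf If] [mg Ig]; split=> [|n]; first exact: measurable_funM.
(* The bound is |f g|^n <= |f|^(2n) + |g|^(2n). *)
apply: le_integrable (integrableD measurableT (If (n * 2)%N) (Ig (n * 2)%N)) =>
  //.
  apply/measurable_EFinP; apply: measurable_funX; apply: measurableT_comp => //.
  exact: measurable_funM.
move=> w _ /=; rewrite lee_fin normrX normr_id normrM exprMn !exprM.
rewrite [leRHS]ger0_norm ?addr_ge0 ?exprn_ge0 //.
have := sqr_ge0 (`|f w| ^+ n - `|g w| ^+ n).
have : 0 <= `|f w| ^+ n * `|g w| ^+ n by rewrite mulr_ge0 ?exprn_ge0.
by nra.
Qed.

Lemma finite_momentsX f n : finite_moments f -> finite_moments (fun w => f w ^+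
  n).
Proof.
move=> ff; elim: n => [|n IH]; first exact: finite_moments_cst.
by under eq_fun do rewrite exprS; exact: finite_momentsM.
Qed.

Lemma finite_moments_indic (A : set T) : measurable A ->
  finite_moments (\1_A : T -> R).
Proof.
move=> mA; split=> [|n]; first exact: measurable_indic.
have : P.-integrable setT (EFin \o cst (1 : R)).
  exact: finite_measure_integrable_cst.
apply: le_integrable => //.
  by apply/measurable_EFinP; apply: measurable_funX; apply: measurableT_comp;
    [|exact: measurable_indic].
move=> w _; rewrite lee_fin normr1 indicE normrX normr_id normr_nat.
by rewrite exprn_ile1 // lern1 leq_b1.
Qed.

Lemma finite_moments_horner (p : {poly R}) f : finite_moments f ->
  finite_moments (fun w => p.[f w]).
Proof.
move=> ff; elim/poly_ind: p => [|p c IH].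
  by under eq_fun do rewrite horner0; exact: finite_moments_cst.
under eq_fun do rewrite hornerMXaddC; apply: finite_momentsD.
  exact: finite_momentsM.
exact: finite_moments_cst.
Qed.

Definition mean f : R := \int[P]_w f w.

Lemma meanD f g : finite_moments f -> finite_moments g ->
  mean (fun w => f w + g w) = mean f + mean g.
Proof.
by move=> ff fg; rewrite /mean RintegralD //; exact: finite_moments_integrable.
Qed.

Lemma meanZ c f : finite_moments f -> mean (fun w => c * f w) = c * mean f.
Proof.
by move=> ff; rewrite /mean RintegralZl //; exact: finite_moments_integrable.
Qed.

Lemma mean_cst c : mean (fun=> c) = c.
Proof.
by rewrite /mean Rintegral_cst //= probability_setT mulr1.
Qed.

Lemma norm_mean_le f g : finite_moments f -> finite_moments g ->
  (forall w, `|f w| <= g w) -> `|mean f| <= mean g.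
Proof.
move=> ff fg h; apply: (le_trans (le_normr_Rintegral measurableT _)).
  exact: finite_moments_integrable.
apply: le_Rintegral => //; last exact: finite_moments_integrable.
by apply: integrable_norm; exact: finite_moments_integrable.
Qed.

Lemma meanE f : finite_moments f -> (\int[P]_w (f w)%:E = (mean f)%:E)%E.
Proof.
move=> ff; rewrite /mean /Rintegral fineK //.
by apply: integrable_fin_num => //; exact: finite_moments_integrable.
Qed.

Lemma integral_set_mean (A : set T) f : measurable A -> finite_moments f ->
  (\int[P]_(w in A) (f w)%:E = (mean (fun w => \1_A w * f w))%:E)%E.
Proof.
move=> mA ff; rewrite -meanE; last first.
  by apply: finite_momentsM => //; exact: finite_moments_indic.
rewrite integral_mkcond; apply: eq_integral => w _.
by rewrite patchE indicE; case: (w \in A); rewrite ?mul1r ?mul0r.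
Qed.

End FiniteMoments.

(** * Conditional expectations compared through their integrals *)

Section ConditionalEquality.
Context (d : measure_display) (T : measurableType d) (R : realType).
Context (P : probability T R) (G : set_system T).
Hypothesis G_measurable : <<s G>> `<=` measurable.
Local Notation T' := (g_sigma_algebraType G).
Local Notation fm := (finite_moments P).
Implicit Types U V W : T -> R.

(** Expresses E[U | G] = E[V | G] without choosing versions; neither function has to be
    G-measurable. *)
Definition same_cond_exp U V : Prop := forall A, <<s G>> A ->
  mean P (fun w => \1_A w * U w) = mean P (fun w => \1_A w * V w).

Lemma same_cond_expP U V : fm U -> fm V -> same_cond_exp U V <->
  forall A, <<s G>> A ->
    (\int[P]_(w in A) (U w)%:E = \int[P]_(w in A) (V w)%:E)%E.
Proof.
move=> fU fV; split=> UV A GA; have := UV A GA;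
  rewrite !integral_set_mean //; try exact: G_measurable.
  by move=> ->.
by case.
Qed.

Lemma mean_pull_out W U V : fm W -> fm U -> fm V ->
  measurable_fun (setT : set T') W -> same_cond_exp U V ->
  mean P (fun w => W w * U w) = mean P (fun w => W w * V w).
Proof.
move=> fW fU fV mW /(same_cond_expP fU fV) UV.
have fN f : fm f -> fm (fun w => -1 * f w).
  by move=> ff; apply: finite_momentsM => //; exact: finite_moments_cst.
have fD : fm (fun w => U w + -1 * V w) by apply: finite_momentsD => //;
  exact: fN.
apply/eqP; rewrite -subr_eq0 -mulN1r -meanZ; last exact: finite_momentsM.
rewrite -meanD; try by [exact: finite_momentsM | apply: fN;
  exact: finite_momentsM].
under eq_fun do rewrite mulrCA -mulrDr.
apply/eqP/EFin_inj; rewrite -meanE; last exact: finite_momentsM.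
apply: (integral_pull_out G_measurable _ mW).
- exact: finite_moments_integrable.
- by apply: (@finite_moments_integrable _ _ _ P (fun w => W w * _));
  exact: finite_momentsM.
move=> A GA; have mA := G_measurable GA.
have iS f : fm f -> P.-integrable A (EFin \o f).
  by move=> ff; apply: integrableS (finite_moments_integrable ff).
under eq_integral do rewrite mulN1r EFinB.
rewrite integralB ?iS // UV // subee //.
by apply: integrable_fin_num => //; exact: iS.
Qed.

Lemma is_cond_exp_same U V : fm U -> fm V ->
  is_cond_exp P <<s G>> U V -> same_cond_exp U V.
Proof.
move=> fU fV [E [_ /Lfun1_integrable iE mE UE] EV];
  apply/same_cond_expP => // A GA.
have mA := G_measurable GA; rewrite -UE //; apply: ae_eq_integral => //.
- apply: (measurable_funS measurableT) => //; exact: measurable_int iE.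
- by apply: (measurable_funS measurableT) => //; apply/measurable_EFinP;
  case: fV.
- by apply: filterS EV => w /= -> _.
Qed.

Lemma same_is_cond_exp U V : fm U -> fm V -> measurable_fun (setT : set T') V ->
  same_cond_exp U V -> is_cond_exp P <<s G>> U V.
Proof.
move=> fU fV mV /(same_cond_expP fU fV) UV.
exists V; last exact: aeW.
split; try by [apply/Lfun1_integrable; exact: finite_moments_integrable].
  by move=> _ [Y mY <-]; exact: mV.
by move=> A GA; rewrite UV.
Qed.

(** The conditional variance comes with its own version of E[U | G]. Almost sure uniqueness replaces
    it by V, and adding its square back gives the conditional second moment. *)
Lemma is_cond_var_same U V W : fm U -> fm V -> fm W ->
  is_cond_exp P <<s G>> U V -> is_cond_var P <<s G>> U W ->
  same_cond_exp (fun w => U w ^+ 2) (fun w => W w + V w ^+ 2).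
Proof.
move=> fU fV fW [E EU EV] [E1 [E2 [E1U E2U EW]]].
apply: is_cond_exp_same; [exact: finite_momentsX| |].
  by apply: finite_momentsD => //; exact: finite_momentsX.
exists E2 => //; have E1E := cond_exp_version_unique G_measurable E1U EU.
by apply: filterS3 E1E EV EW => w /= -> -> <-; rewrite subrK.
Qed.

End ConditionalEquality.

(** * Quadratic harnesses *)

Ltac fm := repeat first [ assumption | exact: finite_moments_cst
  | apply: finite_momentsD | apply: finite_momentsX | apply: finite_momentsM ].

Section Harness.
Context (d : measure_display) (T : measurableType d) (R : realType).
Context (P : probability T R) (X : R -> {RV P >-> R}).
Context (q eta theta sigma tau : R).
Hypothesis X_qh : quadratic_harness X q eta theta sigma tau.
Hypothesis X_moments : all_moments X.
Hypothesis q_le1 : q <= 1.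
Local Notation fm := (finite_moments P).
Local Notation mean := (mean P).

(** The family before closure, because [g_sigma_algebraType] takes a generating family; its closure
    is [sigma_gen X I]. *)
Definition generators (I : set R) : set_system T :=
  \bigcup_(t in I) preimage_set_system setT (X t) measurable.

Local Notation T_ I := (g_sigma_algebraType (generators I)).
Local Notation past_times s := [set t : R | 0 < t <= s].
Local Notation past_future_times s u := [set t : R | 0 < t <= s \/ u <= t].

Lemma generators_measurable I : <<s generators I>> `<=` measurable.
Proof.
apply: smallest_sub; first exact: sigma_algebra_measurable.
by move=> _ [t _ [Y mY <-]]; exact: measurable_funPT.
Qed.

Lemma generators_sub I J : I `<=` J ->
  <<s generators I>> `<=` <<s generators J>>.
Proof. by move=> IJ; apply: sub_sigma_algebra2; exact: bigcup_subset. Qed.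

Lemma measurable_fun_generators (I : set R) t : I t ->
  measurable_fun (setT : set (T_ I)) (X t).
Proof.
move=> It _ Y mY; apply: sub_sigma_algebra.
by exists t => //; exists Y.
Qed.

Lemma fmX t : 0 < t -> fm (X t).
Proof.
move=> t0; split=> // n.
have /Lfun1_integrable := X_moments n t0.
by move/integrable_norm; apply: eq_integrable => // w _ /=; rewrite normrX.
Qed.

(** E[f; A]. With A ranging over the past of s, it stands in for the conditional expectation given
    that past. *)
Definition set_mean (A : set T) (f : T -> R) : R :=
  mean (fun w => \1_A w * f w).

Lemma set_meanD A f g : measurable A -> fm f -> fm g ->
  set_mean A (fun w => f w + g w) = set_mean A f + set_mean A g.
Proof.
move=> mA ff fg; rewrite /set_mean -meanD;
  try by apply: finite_momentsM => //; exact: finite_moments_indic.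
by under eq_fun do rewrite mulrDr.
Qed.

Lemma set_meanZ A c f : measurable A -> fm f ->
  set_mean A (fun w => c * f w) = c * set_mean A f.
Proof.
move=> mA ff; rewrite /set_mean -meanZ; last first.
  by apply: finite_momentsM => //; exact: finite_moments_indic.
by under eq_fun do rewrite mulrCA.
Qed.

(** A also belongs to the larger sigma-algebra of J, so its indicator joins W as a factor that can
    be pulled out. *)
Lemma set_mean_pull_out (I J : set R) A W U V : I `<=` J ->
  <<s generators I>> A -> fm W -> measurable_fun (setT : set (T_ J)) W ->
  fm U -> fm V -> same_cond_exp P (generators J) U V ->
  set_mean A (fun w => W w * U w) = set_mean A (fun w => W w * V w).
Proof.
move=> IJ IA fW mW fU fV UV; rewrite /set_mean.
under eq_fun do rewrite mulrA; symmetry.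
under eq_fun do rewrite mulrA; symmetry.
have JA := generators_sub IJ IA.
apply: (mean_pull_out (@generators_measurable J)) UV => //.
  apply: finite_momentsM => //; apply: finite_moments_indic.
  exact: generators_measurable IA.
by apply: measurable_funM => //; exact: measurable_indic.
Qed.

Lemma meanX t : 0 < t -> mean (X t) = 0.
Proof.
move=> t0; have := qh_mean X_qh t0; rewrite unlock meanE; last exact: fmX.
by case.
Qed.

Lemma meanXX s t : 0 < s -> 0 < t -> mean (fun w => X s w * X t w) = Num.min s
  t.
Proof.
move=> s0 t0; have := qh_cov X_qh s0 t0; rewrite unlock meanE; first by case.
by apply: finite_momentsM; exact: fmX.
Qed.

(** The linear regression tested against W on A, with the denominator u - s cleared. W may depend on
    X_u, which is what allows W = p_n(X_u; u) later. *)
Lemma harness_pull_out s t u A W : 0 < s -> s < t -> t < u ->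
  <<s generators (past_times s)>> A -> fm W ->
  measurable_fun (setT : set (T_ (past_future_times s u))) W ->
  (u - s) * set_mean A (fun w => W w * X t w) =
  (u - t) * set_mean A (fun w => W w * X s w) +
  (t - s) * set_mean A (fun w => W w * X u w).
Proof.
move=> s0 st tu sA fW mW.
have t0 := lt_trans s0 st; have u0 := lt_trans t0 tu.
have mA := generators_measurable sA.
have fs := fmX s0; have ft := fmX t0; have fu := fmX u0.
have fZ c r : 0 < r -> fm (fun w => c * X r w).
  by move=> r0; apply: finite_momentsM (finite_moments_cst P c) (fmX r0).
have fY := finite_momentsD (fZ ((u - t) / (u - s)) s s0) (fZ ((t - s) / (u -
  s)) u u0).
have H := is_cond_exp_same (@generators_measurable _) ft fY (qh_cond_exp X_qh
  s0 st tu).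
rewrite (set_mean_pull_out _ sA fW mW ft fY H); last by move=> r; left.
have -> : (fun w => W w * ((u - t) / (u - s) * X s w + (t - s) / (u - s) * X u
  w)) =
    (fun w => (u - t) / (u - s) * (W w * X s w) + (t - s) / (u - s) * (W w * X
      u w)).
  by apply/funext => w; ring.
have fWs := finite_momentsM fW fs; have fWu := finite_momentsM fW fu.
have fc c f : fm f -> fm (fun w => c * f w).
  by move=> ff; apply: finite_momentsM (finite_moments_cst P c) ff.
rewrite set_meanD ?set_meanZ //; try exact: fc.
by field; rewrite subr_eq0 gt_eqF // (lt_trans st).
Qed.

Definition varden s u : R := u * (1 + sigma * s) + tau - q * s.

Lemma varden_gt0 s u : 0 < s -> s < u -> 0 < varden s u.
Proof.
move=> s0 su; rewrite /varden.
have ? := qh_sigma X_qh; have ? := qh_tau X_qh.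
rewrite (_ : _ - _ = (u - s) + ((1 - q) * s + (u * (sigma * s) + tau))).
  have [s_ge0 u_ge0] := (ltW s0, ltW (lt_trans s0 su)).
  by rewrite ltr_pwDl ?subr_gt0 // !addr_ge0 ?mulr_ge0 ?subr_ge0.
by ring.
Qed.

Lemma quadratic_harness_pull_out s t u A W : 0 < s -> s < t -> t < u ->
  <<s generators (past_times s)>> A -> fm W ->
  measurable_fun (setT : set (T_ (past_future_times s u))) W ->
  let kappa := (u - t) * (t - s) / varden s u in
  (u - s) ^+ 2 * set_mean A (fun w => W w * (X t w * X t w)) =
  ((u - t) ^+ 2 + kappa * (sigma * u ^+ 2 + tau + (1 - q) * u)) *
    set_mean A (fun w => W w * (X s w * X s w)) +
  (2 * (u - t) * (t - s) -
     kappa * (2 * sigma * u * s + 2 * tau + (1 - q) * (u + s))) *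
    set_mean A (fun w => W w * (X s w * X u w)) +
  ((t - s) ^+ 2 + kappa * (sigma * s ^+ 2 + tau + (1 - q) * s)) *
    set_mean A (fun w => W w * (X u w * X u w)) +
  kappa * (u - s) ^+ 2 * set_mean A W +
  kappa * (u - s) * (eta * u - theta) * set_mean A (fun w => W w * X s w) +
  kappa * (u - s) * (theta - eta * s) * set_mean A (fun w => W w * X u w).
Proof.
move=> s0 st tu sA fW mW kappa.
have t0 := lt_trans s0 st; have u0 := lt_trans t0 tu; have su := lt_trans st tu.
have mA := generators_measurable sA.
have fs := fmX s0; have ft := fmX t0; have fu := fmX u0.
have fc c f : fm f -> fm (fun w => c * f w).
  by move=> ff; apply: finite_momentsM (finite_moments_cst P c) ff.
have fY := finite_momentsD (fc ((u - t) / (u - s)) _ fs) (fc ((t - s) / (u -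
  s)) _ fu).
pose V w := (u - t) * (t - s) / (u * (1 + sigma * s) + tau - q * s) *
  (1 + eta * tDelta X s u w + theta * Delta X s u w +
   sigma * tDelta X s u w ^+ 2 + tau * Delta X s u w ^+ 2 -
   (1 - q) * Delta X s u w * tDelta X s u w).
(* [Q] is the conditional second moment, variance plus squared regression, expanded in the monomials
   of X_s and X_u. *)
pose Q w := (u - s) ^- 2 * (
  ((u - t) ^+ 2 + kappa * (sigma * u ^+ 2 + tau + (1 - q) * u)) * (X s w * X s
    w) +
  (2 * (u - t) * (t - s) -
     kappa * (2 * sigma * u * s + 2 * tau + (1 - q) * (u + s))) * (X s w * X u
       w) +
  ((t - s) ^+ 2 + kappa * (sigma * s ^+ 2 + tau + (1 - q) * s)) * (X u w * X u
    w) +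
  kappa * (u - s) ^+ 2 * 1 +
  kappa * (u - s) * (eta * u - theta) * X s w +
  kappa * (u - s) * (theta - eta * s) * X u w).
have us0 : u - s != 0 by rewrite subr_eq0 gt_eqF.
have VQ w : V w + ((u - t) / (u - s) * X s w + (t - s) / (u - s) * X u w) ^+ 2
  = Q w.
  have D0 : varden s u != 0 by rewrite gt_eqF ?varden_gt0.
  rewrite /V /Q /kappa /Delta /tDelta -/(varden s u); field.
  by rewrite us0 D0.
have fB f g : fm f -> fm g -> fm (fun w => f w - g w).
  move=> ff fg; have : fm (fun w => f w + -1 * g w) by fm.
  by congr (fm _); apply/funext => w; rewrite mulN1r.
have fD : fm (Delta X s u) by apply: finite_momentsM; [exact: fB|fm].
have ftD : fm (tDelta X s u).
  by apply: finite_momentsM; [apply: fB; fm | fm].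
have fV : fm V by apply: finite_momentsM; [fm | apply: fB; fm].
have H := is_cond_var_same (@generators_measurable _) ft fY fV
  (qh_cond_exp X_qh s0 st tu) (qh_cond_var X_qh s0 st tu).
have -> : (fun w => W w * (X t w * X t w)) = (fun w => W w * X t w ^+ 2).
  by apply/funext => w; rewrite expr2.
rewrite (set_mean_pull_out _ sA fW mW _ _ H); first last.
- by fm.
- by fm.
- by move=> r; left.
under eq_fun do rewrite VQ.
rewrite /Q; set c1 := _ + _ * (_ + _ + (1 - q) * u); set c2 := 2 * _ * _ - _.
set c3 := _ + _ * (_ + _ + (1 - q) * s); set c4 := kappa * _ ^+ 2.
set c5 := _ * (_ - theta); set c6 := _ * (theta - _).
have -> : (fun w => W w * ((u - s) ^- 2 * (c1 * (X s w * X s w) +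
    c2 * (X s w * X u w) + c3 * (X u w * X u w) + c4 * 1 + c5 * X s w +
    c6 * X u w))) =
  (fun w => (u - s) ^- 2 * (c1 * (W w * (X s w * X s w)) +
    c2 * (W w * (X s w * X u w)) + c3 * (W w * (X u w * X u w)) + c4 * W w +
    c5 * (W w * X s w) + c6 * (W w * X u w))).
  by apply/funext => w; ring.
rewrite set_meanZ ?mulVKf ?expf_neq0 //; last by fm.
by rewrite !set_meanD ?set_meanZ //; fm.
Qed.

End Harness.

(** * Martingale property and orthogonality *)

Section MartingalePolynomials.
Context (d : measure_display) (T : measurableType d) (R : realType).
Context (P : probability T R) (X : R -> {RV P >-> R}).
Context (q eta theta sigma tau : R).
Hypothesis X_qh : quadratic_harness X q eta theta sigma tau.
Hypothesis X_moments : all_moments X.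
Hypotheses (st_lt1 : sigma * tau < 1) (q_gtN1 : -1 < q).
Hypothesis q_le : q <= 1 - 2 * Num.sqrt (sigma * tau).
Context (alpha beta gamma delta omega : nat -> R).
Hypothesis qc :
  qh_coefficients q eta theta sigma tau alpha beta gamma delta omega.
Context (p : nat -> R -> {poly R}).
Hypothesis p_rec :
  three_term_recurrence sigma tau alpha beta gamma delta omega p.
Local Notation fm := (finite_moments P).
Local Notation mean := (mean P).
Local Notation set_mean := (set_mean P).
Local Notation a := (coef_a sigma alpha beta).
Local Notation jx := (jacobi_x sigma alpha beta gamma omega).
Local Notation jy := (jacobi_y tau alpha beta delta omega).
Local Notation past_times s := [set t : R | 0 < t <= s].
Local Notation generators := (generators X).
Local Notation T_ I := (g_sigma_algebraType (generators I)).
Local Notation varden := (varden q sigma tau).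

Let sigma_ge0 : 0 <= sigma. Proof. exact: qh_sigma X_qh. Qed.
Let tau_ge0 : 0 <= tau. Proof. exact: qh_tau X_qh. Qed.

Let q_le1 : q <= 1.
Proof. by have := sqrtr_ge0 (sigma * tau); have := q_le; lra. Qed.

Let a_gt0 n t : 0 <= t -> 0 < a n t.
Proof. exact: (coef_a_gt0 sigma_ge0 tau_ge0 st_lt1 q_gtN1 q_le qc). Qed.

(** Row n of t x + y sees the index n + 1 only through its entry a_n(t), so a defect in the top
    degree enters with that factor. *)
Lemma jacobi_top l v n t : (forall k, (k <= n)%N -> v k = l k) ->
  t * jx v n + jy v n = t * jx l n + jy l n + a n t * (v n.+1 - l n.+1).
Proof.
move=> vl; by rewrite /jacobi_x /jacobi_y /coef_a (vl n) // (vl n.-1) ?leq_pred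
  //; ring.
Qed.

Lemma jacobi_ext l v n t : (forall k, (k <= n.+1)%N -> v k = l k) ->
  t * jx v n + jy v n = t * jx l n + jy l n.
Proof.
move=> vl; rewrite (jacobi_top (l := l)) ?vl ?subrr ?mulr0 ?addr0 //.
by move=> k kn; rewrite vl // leqW.
Qed.

Lemma jacobi_comp l s u n :
  u * jx (fun j => s * jx l j + jy l j) n + jy (fun j => s * jx l j + jy l j) n
    =
  u * s * jx (jx l) n + u * jx (jy l) n + s * jy (jx l) n + jy (jy l) n.
Proof. by rewrite /jacobi_x /jacobi_y; ring. Qed.

(** * Means of the polynomials and the induction step *)

Definition pX n t (w : T) : R := (p n t).[X t w].

Lemma fm_pX n t : 0 < t -> fm (pX n t).
Proof. by move=> t0; apply: finite_moments_horner; exact: fmX. Qed.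

Lemma measurable_pX (I : set R) n t : I t ->
  measurable_fun (setT : set (T_ I)) (pX n t).
Proof.
move=> It; rewrite /pX; elim/poly_ind: (p n t) => [|r c IH].
  by under eq_fun do rewrite horner0; exact: measurable_cst.
under eq_fun do rewrite hornerMXaddC.
apply: measurable_funD => //; apply: measurable_funM => //.
exact: measurable_fun_generators.
Qed.

Lemma eq_set_mean A f g : (forall w, f w = g w) -> set_mean A f = set_mean A g.
Proof. by move=> /funext ->. Qed.

Lemma set_mean_three_term A W t n : measurable A -> fm W -> 0 < t ->
  let v j := set_mean A (fun w => W w * pX j t w) in
  set_mean A (fun w => W w * (X t w * pX n t w)) = t * jx v n + jy v n.
Proof.
move=> mA fW t0 v; rewrite -coef_jacobi /v.
set a' := coef_a _ _ _ _ _; set b' := coef_b _ _ _ _;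
  set c' := coef_c _ _ _ _ _ _.
have fp k := fm_pX k t0.
rewrite -!set_meanZ -?set_meanD //; try by fm.
apply: eq_set_mean => w; rewrite /pX.
rewrite (three_term_horner (qc_alpha0 qc) (qc_beta0 qc) (qc_alpha1 qc)
  (qc_beta1 qc) (qc_gamma0 qc) (qc_delta0 qc) p_rec n _ t0).
by rewrite -/a' -/b' -/c'; ring.
Qed.

Definition martingale_at n : Prop := forall s t, 0 < s -> s < t ->
  same_cond_exp P (generators (past_times s)) (pX n t) (pX n s).

Lemma martingale_pull_out n s r u A V : martingale_at n -> 0 < s -> s <= r ->
  r < u -> <<s generators (past_times s)>> A -> fm V ->
  measurable_fun (setT : set (T_ (past_times r))) V ->
  set_mean A (fun w => V w * pX n u w) = set_mean A (fun w => V w * pX n r w).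
Proof.
move=> Mn s0 sr ru sA fV mV; have r0 := lt_le_trans s0 sr.
have u0 := lt_trans r0 ru.
apply: (set_mean_pull_out _ sA fV mV (fm_pX n u0) (fm_pX n r0) (Mn _ _ r0 ru)).
by move=> t /= /andP[-> /le_trans ->].
Qed.

Lemma martingale_step n : (forall k, (k <= n.+1)%N -> martingale_at k) ->
  martingale_at n.+2.
Proof.
move=> IH s u s0 su A sA.
have mA := generators_measurable sA; have u0 := lt_trans s0 su.
(* [l] holds the means at the base time s, [G] is the defect in the new degree, and [l_ r] is the
   image of [l] under r x + y. *)
pose l j := set_mean A (pX j s); pose G t := set_mean A (pX n.+2 t) - l n.+2.
pose l_ t j := t * jx l j + jy l j.
suff : G u = 0 by move/eqP; rewrite subr_eq0 => /eqP.
have one_mul f : (fun w => 1 * f w) = f :> (T -> R).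
  by apply/funext => w; rewrite mul1r.
have f1 : fm (fun=> 1) by exact: finite_moments_cst.
have fX r : 0 < r -> fm (X r) by exact: fmX.
have mX (I : set R) r : I r -> measurable_fun (setT : set (T_ I)) (X r).
  exact: measurable_fun_generators.
have L k r : (k <= n.+1)%N -> s <= r -> set_mean A (pX k r) = l k.
  move=> kn; rewrite le_eqVlt => /predU1P[<- //|sr].
  exact: (IH k kn s r s0 sr A sA).
have XP r k : (k <= n.+1)%N -> s <= r ->
    set_mean A (fun w => X r w * pX k r w) =
    l_ r k + a k r * (set_mean A (pX k.+1 r) - l k.+1).
  move=> kn sr; have r0 := lt_le_trans s0 sr.
  rewrite -[X in set_mean A X]one_mul set_mean_three_term //.
  rewrite (jacobi_top (l := l)) ?one_mul // => j jk.
  by rewrite one_mul L // (leq_trans jk).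
have XPn r k : (k <= n)%N -> s <= r ->
    set_mean A (fun w => X r w * pX k r w) = l_ r k.
  by move=> kn sr; rewrite XP ?leqW // L // subrr mulr0 addr0.
have XsP k : (k <= n.+1)%N -> set_mean A (fun w => X s w * pX k u w) = l_ s k.
  move=> kn; rewrite (martingale_pull_out (IH k kn) s0 (lexx s) su sA) //.
  - by rewrite XP // subrr mulr0 addr0.
  - exact: fX.
  - by apply: mX; rewrite /= s0 lexx.
pose t := (s + u) / 2; have [st tu] : s < t /\ t < u by rewrite !midf_lt.
have t0 := lt_trans s0 st.
have pf_pX k : measurable_fun
    (setT : set (T_ [set r : R | 0 < r <= s \/ u <= r])) (pX k u).
  by apply: measurable_pX; right; exact: lexx.
have past_Xt : measurable_fun (setT : set (T_ (past_times t))) (X t).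
  by apply: mX; rewrite /= t0 lexx.
(* First equation, from E[X_t p_(n+1)(X_u); A]. The parts free of [G] cancel because [l_ r] is
   affine in r. *)
have E1 : (u - s) * (a n.+1 t * G t) = (t - s) * (a n.+1 u * G u).
  have := harness_pull_out X_qh X_moments s0 st tu sA (fm_pX n.+1 u0) (pf_pX
    n.+1).
  have comm r : (fun w => pX n.+1 u w * X r w) = (fun w => X r w * pX n.+1 u w).
    by apply/funext => w; rewrite mulrC.
  rewrite !comm.
  rewrite (martingale_pull_out (IH _ (leqnn _)) s0 (ltW st) tu sA (fX t t0)) //.
  rewrite XsP // !XP ?ltW // -/(G t) -/(G u) /l_ => E.
  apply: (eq_lin_comb (c := 1) E); ring.
have Stt r : s <= r -> set_mean A (fun w => pX n r w * (X r w * X r w)) =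
    r * jx (l_ r) n + jy (l_ r) n + a n r * (a n.+1 r * G r).
  move=> sr; have r0 := lt_le_trans s0 sr.
  rewrite (_ : set_mean A _ = set_mean A (fun w => X r w * (X r w * pX n r w))).
    rewrite (set_mean_three_term n mA (fX r r0) r0) /= (jacobi_top (l := l_ r))
      => [|k kn].
      by rewrite XP // (addrC (l_ r n.+1)) addrK.
    by rewrite XPn.
  by apply: eq_set_mean => w; ring.
have XX_out r : s <= r -> r < u ->
    set_mean A (fun w => pX n u w * (X r w * X r w)) =
    set_mean A (fun w => pX n r w * (X r w * X r w)).
  move=> sr ru; have r0 := lt_le_trans s0 sr.
  have comm v : (fun w => pX n v w * (X r w * X r w)) =
      (fun w => (X r w * X r w) * pX n v w).
    by apply/funext => w; rewrite mulrC.
  rewrite !comm (martingale_pull_out (IH n (leqnSn n)) s0 sr ru sA) //.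
    by have fr := fX r r0; fm.
  by apply: measurable_funM; apply: mX; rewrite /= r0 lexx.
have Ssu : set_mean A (fun w => pX n u w * (X s w * X u w)) =
    u * jx (l_ s) n + jy (l_ s) n.
  rewrite (_ : set_mean A _ = set_mean A (fun w => X s w * (X u w * pX n u w))).
    by rewrite (set_mean_three_term n mA (fX s s0) u0) /= (jacobi_ext (l := l_
      s)).
  by apply: eq_set_mean => w; ring.
(* Second equation, from E[X_t^2 p_n(X_u); A]. Two uses of the recurrence bring in the factor a_n
   a_(n+1), and the weight of X_u^2 simplifies to (t - s) (u - s) [varden s t] / [varden s u]. *)
have E2 : (u - s) * varden s u * (a n t * (a n.+1 t * G t)) =
    (t - s) * varden s t * (a n u * (a n.+1 u * G u)).
  have := quadratic_harness_pull_out X_qh X_moments q_le1 s0 st tu sA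
    (fm_pX n u0) (pf_pX n).
  have comm r : (fun w => pX n u w * X r w) = (fun w => X r w * pX n u w).
    by apply/funext => w; rewrite mulrC.
  rewrite /= !comm Ssu !XX_out ?lexx ?ltW // !Stt ?lexx ?ltW //.
  rewrite XsP // XPn ?ltW // L ?ltW //.
  have -> : G s = 0 by rewrite /G subrr.
  rewrite mulr0 mulr0 addr0 /l_ !jacobi_comp.
  have := q_commutation sigma_ge0 tau_ge0 st_lt1 q_gtN1 q_le qc l n.
  set XX := jx (jx l) n; set XY := jx (jy l) n; set YX := jy (jx l) n.
  set YY := jy (jy l) n; set x := jx l n; set y := jy l n.
  set gt := a n t * _; set gu := a n u * _ => QC.
  (* Eliminating [l n] by the commutation relation makes all terms free of the defect cancel. *)
  have -> : l n = YX - q * XY - eta * y - theta * x - sigma * YY - tau * XX.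
    by apply: (eq_lin_comb (c := -1) QC); ring.
  have N0 : varden s u != 0 by rewrite gt_eqF ?(varden_gt0 X_qh q_le1).
  have us0 : u - s != 0 by rewrite subr_eq0 gt_eqF.
  move=> E; apply: (mulfI us0).
  apply: (eq_lin_comb (c := varden s u) E).
  by move: N0; rewrite /varden => N0; field.
(* Up to positive factors this is the determinant of the system [E1], [E2] in [G t] and [G u]; its
   positivity forces [G u] to vanish. *)
have bracket : a n t * varden s u - a n u * varden s t =
    (u - t) * a n.+1 s.
  rewrite /coef_a /varden (alphaSS qc) (betaSS qc); ring.
have : (u - s) * (t - s) * ((u - t) * a n.+1 s) * a n.+1 u * G u = 0.
  rewrite -bracket; apply: (eq_lin_comb (c := u - s) E2).
  apply: (eq_lin_comb (c := - ((u - s) * varden s u * a n t)) E1); ring.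
have coef_gt0 : 0 < (u - s) * (t - s) * ((u - t) * a n.+1 s) * a n.+1 u.
  by rewrite !mulr_gt0 ?subr_gt0 ?a_gt0 // ltW.
by move/eqP; rewrite mulf_eq0 gt_eqF //= => /eqP.
Qed.

(** * Degrees zero and one *)

Lemma le0_of_small (x K : R) : 0 <= K ->
  (forall c, 0 < c -> c < 1 -> x <= c * K) -> x <= 0.
Proof.
move=> K0 xK; apply/ler_addgt0Pr => e e0; rewrite add0r.
have K1 : 0 < K + 1 by rewrite ltr_wpDl.
pose c := Num.min (1 / 2) (e / (K + 1)).
have c0 : 0 < c by rewrite lt_min !divr_gt0.
apply: (le_trans (xK c c0 _)); first by rewrite gt_min; apply/orP; left; lra.
apply: (@le_trans _ _ (e / (K + 1) * K)).
  by rewrite ler_wpM2r // ge_min lexx orbT.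
by rewrite mulrAC ler_pdivrMr // ler_wpM2l ?(ltW e0) // lerDl.
Qed.

(** Cauchy-Schwarz in the weighted arithmetic-geometric form, which avoids square roots; the weight
    c is chosen to suit each use. *)
Lemma norm_mean_mul_le (f g : T -> R) c : 0 < c -> fm f -> fm g ->
  `|mean (fun w => f w * g w)| <=
  (c^-1 * mean (fun w => f w * f w) + c * mean (fun w => g w * g w)) / 2.
Proof.
move=> c0 ff fg; rewrite mulrDl ![_ / 2]mulrC !mulrA -!meanZ; [|fm|fm].
rewrite -meanD; [|fm|fm].
apply: norm_mean_le; [fm|fm|] => w; rewrite normrM.
have sq x : x * x = `|x| ^+ 2 :> R by rewrite real_normK ?num_real.
rewrite (sq (f w)) (sq (g w)).
rewrite -subr_ge0 (_ : _ - _ =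
  (2^-1 * c^-1) * (`|f w| - c * `|g w|) ^+ 2); last by field; rewrite gt_eqF.
by rewrite mulr_ge0 ?sqr_ge0 // mulr_ge0 ?invr_ge0 // ltW.
Qed.

Lemma mean_increment_sqr s u : 0 < s -> s < u ->
  mean (fun w => (X u w + -1 * X s w) * (X u w + -1 * X s w)) = u - s.
Proof.
move=> s0 su; have u0 := lt_trans s0 su.
have fs := fmX X_moments s0; have fu := fmX X_moments u0.
rewrite (_ : (fun w => _) = (fun w => X u w * X u w + -2 * (X s w * X u w) +
  X s w * X s w)); last by apply/funext => w; ring.
rewrite !meanD ?meanZ; do ?fm.
rewrite !(meanXX X_qh X_moments) // !minxx min_l ?ltW //; ring.
Qed.

Lemma martingale_at0 : martingale_at 0.
Proof.
move=> s t s0 st A sA; rewrite /pX.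
have [-> _ _] := p_rec s0; have [-> _ _] := p_rec (lt_trans s0 st).
by congr mean; apply/funext => w; rewrite !hornerE.
Qed.

(* The harness makes G t := E[X_t; A] - E[X_s; A] proportional to t - s, while
   the covariance only allows growth of order (t - s)^(1/2). *)
Lemma martingale_at1 : martingale_at 1.
Proof.
move=> s t s0 st A sA; have t0 := lt_trans s0 st;
  have mA := generators_measurable sA.
have pXE r : 0 < r -> pX 1 r = X r.
  move=> r0; apply/funext => w; rewrite /pX.
  by have [_ -> _] := p_rec r0; rewrite hornerX.
rewrite !pXE // -!/(set_mean A _).
pose G r := set_mean A (X r) - set_mean A (X s).
have f1 : fm (fun=> 1) by exact: finite_moments_cst.
have fA : fm (\1_A) by exact: finite_moments_indic.
have fs := fmX X_moments s0.
have one_mul f : (fun w => 1 * f w) = f :> (T -> R).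
  by apply/funext => w; rewrite mul1r.
have G_lin u : t < u -> (u - s) * G t = (t - s) * G u.
  move=> tu.
  have := harness_pull_out X_qh X_moments s0 st tu sA f1 (measurable_cst _).
  by rewrite !one_mul /G => E; apply: (eq_lin_comb (c := 1) E); ring.
(* The increment over a time c^2 has second moment c^2, so the weight c turns the estimate into at
   most (c + c) / 2. *)
have G_le c : 0 < c -> `|G (s + c ^+ 2)| <= c.
  move=> c0; set u := s + c ^+ 2.
  have su : s < u by rewrite ltrDl exprn_gt0.
  have fu := fmX X_moments (lt_trans s0 su).
  have -> : G u = mean (fun w => (X u w + -1 * X s w) * \1_A w).
    rewrite /G -[- set_mean A (X s)]mulN1r -set_meanZ // -set_meanD //; [|fm].
    by congr mean; apply/funext => w; rewrite mulrC.
  apply: (le_trans (norm_mean_mul_le c0 _ fA)); first by fm.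
  rewrite mean_increment_sqr //.
  have mA1 : mean (fun w => \1_A w * \1_A w) <= 1.
    rewrite -[leRHS](mean_cst P); apply: le_trans (ler_norm _) _.
    apply: norm_mean_le; [fm|fm|] => w.
    by rewrite indicE; case: (w \in A); rewrite !(mulr1, mulr0) ?normr1 ?normr0.
  have -> : u - s = c * c by rewrite /u expr2; ring.
  rewrite mulKf ?gt_eqF // ler_pdivrMr //.
  by rewrite mulr_natr mulr2n lerD2l ler_piMr // ltW.
apply/eqP; rewrite -subr_eq0 -normr_le0 -/(G t).
apply: (@le0_of_small _ 1) => // c c0 c1; rewrite mulr1.
(* With u = s + k^2, proportionality gives |G t| <= (t - s) / k <= c. Since c < 1, k exceeds 1 + (t
   - s), so u lies beyond t. *)
pose k := (1 + (t - s)) / c.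
have ts0 : 0 < t - s by rewrite subr_gt0.
have k_gt : 1 + (t - s) < k by rewrite ltr_pdivlMr // gtr_pMr // addr_gt0.
have k0 : 0 < k by rewrite (lt_trans _ k_gt) // addr_gt0.
have tu : t < s + k ^+ 2.
  rewrite -ltrBlDl expr2; apply: (@lt_trans _ _ (1 * k));
    first by rewrite mul1r; lra.
  by rewrite ltr_pM2r //; lra.
have := congr1 (fun x => `|x|) (G_lin _ tu).
rewrite !normrM (addrC s) addrK normrX (gtr0_norm k0) (gtr0_norm ts0) => E.
have : k ^+ 2 * `|G t| <= (t - s) * k.
  by rewrite E ler_pM2l // (addrC _ s) G_le.
rewrite expr2 -mulrA (mulrC k) ler_pM2r // mulrC -ler_pdivlMr // => /le_trans;
  apply.
have d0 : 0 < 1 + (t - s) by rewrite addr_gt0.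
rewrite /k invf_div mulrA ler_pdivrMr // [leRHS]mulrDr mulr1 (mulrC c).
by rewrite lerDr ltW.
Qed.

Lemma martingale_all n : martingale_at n.
Proof.
elim/ltn_ind: n => -[|[|n]] IH; [exact: martingale_at0|exact: martingale_at1|].
by apply: martingale_step => k kn; exact: IH.
Qed.

(** * Vanishing means and orthogonality *)

Lemma set_mean_setT f : set_mean setT f = mean f.
Proof. by congr mean; apply/funext => w; rewrite indicT mul1r. Qed.

Lemma generators_setT I : <<s generators I>> setT.
Proof.
by have := @measurableT _ (T_ I).
Qed.

Lemma mean_pX_const n s t : 0 < s -> s < t -> mean (pX n t) = mean (pX n s).
Proof.
move=> s0 st; rewrite -(set_mean_setT (pX n t)) -(set_mean_setT (pX n s)).
exact: (martingale_all n s0 st (@generators_setT _)).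
Qed.

Lemma mean_three_term W n t : fm W -> 0 < t ->
  let v j := mean (fun w => W w * pX j t w) in
  mean (fun w => W w * (X t w * pX n t w)) = t * jx v n + jy v n.
Proof.
move=> fW t0; rewrite -set_mean_setT set_mean_three_term //= /jacobi_x
  /jacobi_y.
by rewrite !set_mean_setT.
Qed.

Lemma mean_pX_eq0 n t : 0 < t -> mean (pX n.+1 t) = 0.
Proof.
elim/ltn_ind: n t => -[|[|n]] IH t t0.
- have [_ E _] := p_rec t0; rewrite -(meanX X_qh X_moments t0).
  by congr mean; apply/funext => w; rewrite /pX E hornerX.
(* Degree two: in the recurrence for X_t p_1 the term c_1(t) p_0 has mean t, which is exactly
   E[X_t^2]. *)
- have [p0 p1 _] := p_rec t0.
  have e1 : mean (pX 1 t) = 0 by exact: IH.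
  have := @mean_three_term (fun=> 1) 1 t (finite_moments_cst _ _) t0.
  rewrite /= -coef_jacobi.
  have one_mul f : (fun w => 1 * f w) = f :> (T -> R).
    by apply/funext => w; rewrite mul1r.
  rewrite !one_mul e1 (_ : pX 0 t = fun=> 1); last first.
    by apply/funext => w; rewrite /pX p0 hornerE.
  rewrite (_ : (fun w => _) = (fun w => X t w * X t w)); last first.
    by apply/funext => w; rewrite /pX p1 hornerX.
  rewrite (meanXX X_qh X_moments) // minxx mean_cst.
  rewrite /coef_c (qc_alpha1 qc) (qc_beta1 qc) (qc_omega1 qc) => E.
  have : a 1 t * mean (pX 2 t) = 0 by apply: (eq_lin_comb (c := -1) E); ring.
  by move/eqP; rewrite mulf_eq0 gt_eqF ?a_gt0 ?ltW //= => /eqP.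
- suff e1 : mean (pX n.+3 1) = 0.
    have [t1|t1|-> //] := ltgtP t 1; first by rewrite -(mean_pX_const _ t0 t1).
    by rewrite (mean_pX_const _ _ t1).
  have fY := fm_pX n.+2 ltr01.
  pose K := mean (fun w => pX n.+2 1 w * pX n.+2 1 w).
  have K0 : 0 <= K.
    apply: Rintegral_ge0 => w _; by rewrite -expr2 sqr_ge0.
  have b0 : 0 < beta n.+3 by have := a_gt0 n.+2 (lexx 0);
    rewrite /coef_a mulr0 add0r.
  apply/eqP; rewrite -normr_le0 -(pmulr_rle0 _ b0).
  apply: (@le0_of_small _ (1 + K)) => [|c c0 c1]; first by rewrite addr_ge0.
  (* With s = c^2 = E[X_s^2], the weight c bounds E[X_s p_(n+2)(X_1)] by c (1 + K) / 2. *)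
  pose s := c ^+ 2; have s0 : 0 < s by rewrite exprn_gt0.
  have s1 : s < 1 by rewrite exprn_ilt1 // ltW.
  have fs := fmX X_moments s0.
  apply: (@le_trans _ _ (a n.+2 s * `|mean (pX n.+3 1)|)).
    rewrite ler_wpM2r // /coef_a lerDr mulr_ge0 ?(ltW s0) //.
    by rewrite mulr_ge0 // (alpha_ge0 sigma_ge0 tau_ge0 st_lt1 q_gtN1 q_le qc).
  have one_mul f : (fun w => 1 * f w) = f :> (T -> R).
    by apply/funext => w; rewrite mul1r.
  (* The martingale property moves p_(n+2) from time 1 to time s; the recurrence at s then leaves
     only its top term, as the lower means vanish by induction. *)
  have E : a n.+2 s * mean (pX n.+3 1) = mean (fun w => X s w * pX n.+2 1 w).
    rewrite (mean_pX_const _ s0 s1) -[RHS]set_mean_setT.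
    have mXs : measurable_fun (setT : set (T_ (past_times s))) (X s).
      by apply: measurable_fun_generators; rewrite /= s0 lexx.
    have sT : <<s generators (past_times s)>> setT by exact: generators_setT.
    rewrite (martingale_pull_out (martingale_all n.+2) s0 (lexx s) s1 sT fs
      mXs).
    rewrite set_mean_setT.
    have := @mean_three_term (fun=> 1) n.+2 s (finite_moments_cst _ _) s0.
    rewrite /= -coef_jacobi !one_mul => ->.
    by rewrite (IH n.+1) // (IH n) // !mulr0 !addr0.
  rewrite -(ger0_norm (ltW (a_gt0 n.+2 (ltW s0)))) -normrM E.
  apply: (le_trans (norm_mean_mul_le c0 fs fY)).
  rewrite (meanXX X_qh X_moments) // minxx -/K /s expr2 mulKf ?gt_eqF //.
  rewrite -{1}[c]mulr1 -mulrDr ler_pdivrMr // ler_peMr ?mulr_ge0 ?addr_ge0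
    ?(ltW c0) //.
  lra.
Qed.

(** Each factor X_t absorbed by the recurrence lowers the degree of p_n by at most one, so the
    degree stays above the remaining exponent until only means of positive degree are left. *)
Lemma mean_Xn_pX_eq0 m n t : 0 < t -> (m < n)%N ->
  mean (fun w => X t w ^+ m * pX n t w) = 0.
Proof.
move=> t0; have ft := fmX X_moments t0.
elim: m n => [|m IH] [//|n] mn.
  rewrite -[RHS](mean_pX_eq0 n t0); congr mean.
  by apply/funext => w; rewrite expr0 mul1r.
rewrite (_ : (fun w => _) = (fun w => X t w ^+ m * (X t w * pX n.+1 t w))).
  rewrite mean_three_term //=; last by fm.
  rewrite /jacobi_x /jacobi_y /= !IH ?(mulr0, addr0) //; lia.
by apply/funext => w; rewrite exprSr mulrA.
Qed.

Lemma mean_sum k (F : nat -> T -> R) : (forall i, fm (F i)) ->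
  mean (fun w => \sum_(i < k) F i w) = \sum_(i < k) mean (F i).
Proof.
move=> fF; elim: k => [|k IH].
  by under eq_fun do rewrite big_ord0; rewrite big_ord0 mean_cst.
have fS : fm (fun w => \sum_(i < k) F i w).
  elim: k {IH} => [|k IH].
    by under eq_fun do rewrite big_ord0; exact: finite_moments_cst.
  by under eq_fun do rewrite big_ord_recr /=; exact: finite_momentsD.
by under eq_fun do rewrite big_ord_recr /=; rewrite meanD // IH big_ord_recr.
Qed.

(** By symmetry m < n, and p_m expands into powers of X_t below n, each orthogonal to p_n. *)
Lemma mean_pXpX_eq0 m n t : 0 < t -> m != n ->
  mean (fun w => pX n t w * pX m t w) = 0.
Proof.
move=> t0; have ft := fmX X_moments t0.
wlog mn : m n / (m < n)%N => [H|_].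
  rewrite neq_ltn => /orP[mn|nm]; first by rewrite H // ltn_eqF.
  by under eq_fun do rewrite mulrC; rewrite H // ltn_eqF.
have -> : (fun w => pX n t w * pX m t w) = (fun w =>
    \sum_(i < size (p m t)) (p m t)`_i * (X t w ^+ i * pX n t w)).
  apply/funext => w; rewrite mulrC {1}/pX horner_coef mulr_suml.
  by apply: eq_bigr => i _; rewrite mulrA.
have fn := fm_pX n t0.
rewrite (mean_sum _ (F := fun i w => (p m t)`_i * (X t w ^+ i * pX n t w))).
  rewrite big1 // => i _; rewrite meanZ; last by fm.
  rewrite mean_Xn_pX_eq0 ?mulr0 //.
  by rewrite (leq_trans (ltn_ord i)) // (size_three_term (qc_alpha0 qc)
    (qc_beta0 qc) (qc_alpha1 qc) (qc_beta1 qc) (qc_gamma0 qc) (qc_delta0 qc)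
      a_gt0 p_rec).
by move=> i; fm.
Qed.

Lemma three_term_orthogonal_martingale : orthogonal_martingale_polys X p.
Proof.
split=> [n t t0|n s t s0 st|n m t t0 nm].
- exact: (size_three_term (qc_alpha0 qc)
    (qc_beta0 qc) (qc_alpha1 qc) (qc_beta1 qc) (qc_gamma0 qc) (qc_delta0 qc)
      a_gt0 p_rec).
- have t0 := lt_trans s0 st.
  apply: (same_is_cond_exp (@generators_measurable _ _ _ _ X (past_times s))
    (fm_pX n t0) (fm_pX n s0)); last exact: martingale_all.
  by apply: measurable_pX; rewrite /= s0 lexx.
- have fn := fm_pX n t0; have fm_ := fm_pX m t0.
  rewrite unlock (meanE (f := fun w => pX n t w * pX m t w)); last by fm.
  by rewrite mean_pXpX_eq0 // eq_sym.
Qed.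

End MartingalePolynomials.

Theorem theorem4p1 (d : measure_display) (T : measurableType d) (R : realType)
    (P : probability T R) (X : R -> {RV P >-> R})
    (q eta theta sigma tau : R)
    (X_separable : separable_process X)
    (X_L2 : square_integrable X)
    (X_qh : quadratic_harness X q eta theta sigma tau)
    (st_ge0 : 0 <= sigma * tau) (st_lt1 : sigma * tau < 1)
    (q_gtN1 : -1 < q) (q_le : q <= 1 - 2 * Num.sqrt (sigma * tau))
    (X_moments : all_moments X)
    (X_support : forall t : R, 0 < t -> infinite_support (X t)) :
  exists alpha beta gamma delta omega : nat -> R,
  exists p : nat -> R -> {poly R},
    [/\ qh_coefficients q eta theta sigma tau alpha beta gamma delta omega,
        forall n k : nat, (1 <= n)%N -> 0 < lam sigma tau alpha beta n k,
        three_term_recurrence sigma tau alpha beta gamma delta omega p &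
        orthogonal_martingale_polys X p].
Proof.
have sigma_ge0 := qh_sigma X_qh; have tau_ge0 := qh_tau X_qh.
have [alpha [beta [gamma [delta [omega qc]]]]] :=
  qh_coefficients_exist q eta theta sigma tau.
have a_gt0 := coef_a_gt0 sigma_ge0 tau_ge0 st_lt1 q_gtN1 q_le qc.
have [p p_rec] := three_term_recurrence_exist tau gamma delta omega a_gt0.
exists alpha, beta, gamma, delta, omega, p; split=> //.
- exact: (lam_gt0 sigma_ge0 tau_ge0 st_lt1 q_gtN1 q_le qc).
- exact: (three_term_orthogonal_martingale X_qh X_moments st_lt1 q_gtN1 q_le qc
  p_rec).
Qed.
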